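(* Let $\zeta$ be a primitive, aperiodic substitution of Salem type on the alphabet $\mathcal{A}=\{1,\dots,d\}$, let $\alpha$ (a Salem number of degree $d$) be the Perron–Frobenius eigenvalue of its substitution matrix, and for $a\in\mathcal{A}$ let $\nu_a$ be the correlation measure associated to $a$ on the self-similar suspension flow $\mathfrak{X}^{\vec p}_\zeta$. Then there exist a positive constant $\kappa\in\mathbb{Q}(\alpha)$ and a constant $c=c(\zeta)>0$, both depending only on $\zeta$, such that for every $A>1$ there exists $\gamma=\gamma(A)>0$ (depending, for the given $\zeta$, only on $A$) with the following property. Let $\omega\in\mathbb{Q}(\alpha)$, $\omega\ne0$, and write $\omega\kappa=\frac1L(l_0+l_1\alpha+\dots+l_{d-1}\alpha^{d-1})$ in reduced form. Suppose that (i) there exists $n\in\{0,\dots,d-1\}$ such that $\mathrm{Tr}(L\kappa\omega\alpha^n)\not\equiv0\pmod L$, and (ii) $L\le A$. Then there exists $r_0=r_0(\omega)>0$ such that $$\nu_a([\omega-r,\omega+r])\le c\,r^{\gamma}\qquad\text{for all } 0<r<r_0\text{ and all }a\in\mathcal{A}.$$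
   Context: Salem number: a real algebraic integer $\alpha>1$ all of whose other Galois conjugates lie in the closed unit disk, with at least one on the unit circle. (Its degree $d$ is then even and $\ge4$.) Reduced form: for $\eta\in\mathbb{Q}(\alpha)$ with $\alpha$ of degree $d$, the expression $\eta=\frac1L(l_0+\dots+l_{d-1}\alpha^{d-1})$ with $L\in\mathbb{N}$, $L\ge1$, $l_0,\dots,l_{d-1}\in\mathbb{Z}$ is in reduced form if $\gcd(l_0,\dots,l_{d-1},L)=1$. Trace: $\mathrm{Tr}(\eta)=\sum_{\sigma:\mathbb{Q}(\alpha)\hookrightarrow\mathbb{C}}\sigma(\eta)$, the sum over all embeddings; it is an integer when $\eta\in\mathbb{Z}[\alpha]$. Substitutions: $d\ge4$ is an even integer and $\mathcal{A}=\{1,\dots,d\}$. A substitution is a map $\zeta:\mathcal{A}\to\mathcal{A}^+$ (finite nonempty words), extended to words and sequences by concatenation. Its substitution matrix is $M_\zeta(a,b)=|\zeta(b)|_a$, the number of occurrences of the letter $a$ in $\zeta(b)$; $\zeta$ is primitive if $M_\zeta$ is primitive. It is of Salem type if it is primitive and the dominant (Perron–Frobenius) eigenvalue of $M_\zeta$ is a Salem number. The substitution subshift $\mathfrak{X}_\zeta\subset\mathcal{A}^{\mathbb{Z}}$ is the set of $(x_n)_{n\in\mathbb{Z}}$ such that every finite block $x_i\dots x_{i+k}$ is a subword of $\zeta^n(a)$ for some $a\in\mathcal{A}$, $n\in\mathbb{N}$; $T$ is the left shift $T((x_n)_n)=(x_{n+1})_n$. For primitive $\zeta$, aperiodic means $\mathfrak{X}_\zeta$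 is infinite. Self-similar suspension flow: $\vec p=(p_a)_{a\in\mathcal{A}}$ is a fixed positive left eigenvector of $M_\zeta$ for the Perron–Frobenius eigenvalue $\alpha$, normalized so that all $p_a\in\mathbb{Z}[\alpha]$. Let $F:\mathfrak{X}_\zeta\times\mathbb{R}\to\mathfrak{X}_\zeta\times\mathbb{R}$, $F(x,t)=(T(x),t-p_{x_0})$. Then $\mathfrak{X}^{\vec p}_\zeta=(\mathfrak{X}_\zeta\times\mathbb{R})/\sim$, where $(x,t)\sim(x',t')$ iff $F^n(x,t)=(x',t')$ for some $n\in\mathbb{Z}$, and $h_t(x,t')=(x,t'+t)$ mod $\sim$. The space is identified with the fundamental domain $\{(x,t): x\in\mathfrak{X}_\zeta,\ 0\le t<p_{x_0}\}$. The flow is uniquely ergodic; $\mu$ denotes its unique invariant Borel probability measure. For $a\in\mathcal{A}$, $\mathfrak{X}^{\vec p}_a=\{(x,t)\in\mathfrak{X}^{\vec p}_\zeta: x_0=a\}$ (in the fundamental domain). Correlation measure: for $f\in L^2(\mathfrak{X}^{\vec p}_\zeta,\mu)$ the spectral measure $\nu_f$ is the finite positive Borel measure on $\mathbb{R}$ with $\int_{\mathbb{R}}e^{2\pi i t\omega}\,d\nu_f(\omega)=\langle f\circ h_t,f\rangle_{L^2(\mu)}$ for all $t\in\mathbb{R}$; $\nu_a:=\nu_f$ for $f=\mathbf{1}_{\mathfrak{X}^{\vec p}_a}$. *)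

(* Defs.v *)
(* Mathematical Components and MathComp-Analysis; R[i] is the field of complex
   numbers over a realType R, from mathcomp-real-closed. *)
From HB Require Import structures.
From mathcomp Require Import all_boot all_order all_algebra.
From mathcomp Require Import complex.
From mathcomp Require Import all_classical all_reals all_analysis.
Import numFieldNormedType.Exports.

Set Implicit Arguments.
Unset Strict Implicit.
Unset Printing Implicit Defensive.

Import Order.TTheory GRing.Theory Num.Theory.

Local Open Scope classical_set_scope.
Local Open Scope complex_scope.
Local Open Scope ring_scope.

Section NumberField.
Context {R : realType}.
Implicit Types (alpha eta : R) (P : {poly rat}).

Definition is_minpoly alpha P :=
  [/\ P \is monic, irreducible_poly P & root (map_poly ratr P) alpha].

Definition has_degree alpha (d : nat) :=
  exists2 P, is_minpoly alpha P & size P = d.+1.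

Definition galois_conjugate alpha (z : R[i]) :=
  exists2 P, is_minpoly alpha P & root (map_poly ratr P) z.

Definition is_salem alpha :=
  [/\ integralOver (intr : int -> R) alpha,
      1 < alpha,
      forall z : R[i], galois_conjugate alpha z -> z != alpha%:C -> `|z| <= 1
    & exists z : R[i],
        [/\ galois_conjugate alpha z, z != alpha%:C & `|z| = 1]].

(* The field Q(alpha); no condition q(alpha) <> 0 is needed, as x / 0 = 0. *)
Definition Qadjoin alpha : set R :=
  [set eta | exists p q : {poly rat},
     eta = (map_poly ratr p).[alpha] / (map_poly ratr q).[alpha]].

(* The ring Z[alpha]. *)
Definition Zadjoin alpha : set R :=
  [set eta | exists p : {poly int}, eta = (map_poly intr p).[alpha]].

Definition reduced_form alpha (d : nat) eta (L : nat) (l : 'I_d -> int) :=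
  [/\ (1 <= L)%N,
      eta = L%:R^-1 * \sum_(i < d) (l i)%:~R * alpha ^+ i
    & gcdn (\big[gcdn/0%N]_(i < d) `|l i|%N) L = 1%N].

(* The embeddings of Q(alpha) in the complex numbers. Each is represented by
   its extension by 0 to a function on R, so that distinct elements of this set
   are distinct embeddings. *)
Definition embeddings alpha : set (R -> R[i]) :=
  [set s | [/\ s 1 = 1,
     {in Qadjoin alpha &, {morph s : x y / x + y >-> x + y}},
     {in Qadjoin alpha &, {morph s : x y / x * y >-> x * y}}
   & forall x, ~ Qadjoin alpha x -> s x = 0]].

Definition trace alpha eta : R[i] := \sum_(s \in embeddings alpha) s eta.

End NumberField.

Section Substitution.
Variable d : nat.

(* The alphabet {1, ..., d} is represented by 'I_d. *)
Record substitution := Substitution {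
  subst_fun :> 'I_d -> seq 'I_d;
  subst_neq0 : forall a, subst_fun a != [::] }.

Implicit Type zeta : substitution.

Definition subst_word zeta (w : seq 'I_d) : seq 'I_d := flatten (map zeta w).

Definition subst_mx zeta : 'M[nat]_d :=
  \matrix_(a, b) count_mem a (zeta b).

Definition primitive_mx (M : 'M[nat]_d) :=
  exists2 k, (0 < k)%N & forall a b, (0 < (M ^+ k) a b)%N.

Definition is_dominant_eigenvalue {R : realType} (M : 'M[nat]_d) (alpha : R) :=
  eigenvalue (map_mx (fun n => n%:R : R) M) alpha /\
  forall z : R[i], eigenvalue (map_mx (fun n => n%:R : R[i]) M) z ->
    z != alpha%:C -> `|z| < alpha%:C.

Definition fullshift : Type := {ptws int -> discrete_topology 'I_d}.

HB.instance Definition _ :=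
  Topological.copy fullshift {ptws int -> discrete_topology 'I_d}.

Definition block (x : fullshift) (i : int) (k : nat) : seq 'I_d :=
  [seq x (i + j%:Z) | j <- iota 0 k.+1].

Definition subshift zeta : set fullshift :=
  [set x | forall i k, exists a n,
     infix (block x i k) (iter n (subst_word zeta) [:: a])].

Definition left_shift (x : fullshift) : fullshift := fun n => x (n + 1).

Lemma left_shift_subshift zeta x :
  subshift zeta x -> subshift zeta (left_shift x).
Proof.
move=> xX i k; have [a [n xa]] := xX (i + 1) k; exists a, n.
rewrite (_ : block _ i k = block x (i + 1) k) //.
by apply: eq_map => j; rewrite /left_shift addrAC.
Qed.

Lemma left_shift_inj : injective left_shift.
Proof.
move=> x y exy; apply/funext => n.
by have := congr1 (@^~ (n - 1)) exy; rewrite /left_shift subrK.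
Qed.

Record pa_substitution := PASubstitution {
  pa_subst :> substitution;
  pa_primitive : primitive_mx (subst_mx pa_subst);
  pa_aperiodic : infinite_set (subshift pa_subst) }.

End Substitution.

Section Suspension.
Local Open Scope quotient_scope.
Context {d : nat} (zeta : pa_substitution d).

Definition subshift_type : Type := set_type (subshift zeta).

HB.instance Definition _ :=
  Topological.copy subshift_type (set_type (subshift zeta)).

Lemma subshift_point : {x : subshift_type | True}.
Proof.
apply: cid; have /set0P[x /mem_set xX] : subshift zeta != set0.
  apply/eqP => X0; apply: (pa_aperiodic (p := zeta)).
  by rewrite X0; exact: finite_set0.
by exists (exist _ x xX).
Qed.

HB.instance Definition _ := isPointed.Build subshift_type (sval subshift_point).

Definition subshift_map (x : subshift_type) : subshift_type :=
  exist _ (left_shift (val x))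
    (mem_set (left_shift_subshift (set_mem (valP x)))).

Lemma subshift_map_inj : injective subshift_map.
Proof. by move=> x y /(congr1 val)/left_shift_inj/val_inj. Qed.

Context {R : realType} (p : 'rV[R]_d).

Definition suspension_map (u : subshift_type * R) : subshift_type * R :=
  (subshift_map u.1, u.2 - p 0 (val u.1 0)).

Lemma suspension_map_inj : injective suspension_map.
Proof.
move=> [x s] [y t] e.
have /subshift_map_inj exy : subshift_map x = subshift_map y := congr1 fst e.
by have := congr1 snd e; rewrite /suspension_map /= exy => /addIr ->.
Qed.

(* The n-th iterate of suspension_map sends u to v, for some integer n; for
   n < 0 this reads: the (-n)-th iterate sends v to u. *)
Definition orbit_rel : rel (subshift_type * R) :=
  fun u v => `[< exists n : nat,
    iter n suspension_map u = v \/ iter n suspension_map v = u >].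

Lemma orbit_rel_equiv : equiv_class_of orbit_rel.
Proof.
have iterI n : injective (iter n suspension_map).
  by elim: n => [|n IHn] // u v /suspension_map_inj/IHn.
have sub m n u v w : iter m suspension_map u = v ->
    iter n suspension_map w = v -> orbit_rel u w.
  move=> uv wv; apply/asboolP; have [mn|/ltnW nm] := leqP m n.
    by exists (n - m)%N; right; apply: (iterI m); rewrite -iterD subnKC// wv.
  by exists (m - n)%N; left; apply: (iterI n); rewrite -iterD subnKC// wv.
have bus m n u v w : iter m suspension_map v = u ->
    iter n suspension_map v = w -> orbit_rel u w.
  move=> <- <-; apply/asboolP; have [mn|/ltnW nm] := leqP m n.
    by exists (n - m)%N; left; rewrite -iterD subnK.
  by exists (m - n)%N; right; rewrite -iterD subnK.
split=> [u|u v|v u w].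
- by apply/asboolP; exists 0%N; left.
- by apply/asboolP/asboolP => -[n [?|?]]; exists n; [right|left|right|left].
- move=> /asboolP[m [uv|vu]] /asboolP[n [vw|wv]].
  + by apply/asboolP; exists (n + m)%N; left; rewrite iterD uv.
  + exact: sub uv wv.
  + exact: bus vu vw.
  + by apply/asboolP; exists (m + n)%N; right; rewrite iterD wv.
Qed.

Canonical orbit_equiv := EquivRelPack orbit_rel_equiv.

Definition suspension_top : Type := quotient_topology {eq_quot orbit_equiv}.

HB.instance Definition _ :=
  Topological.copy suspension_top (quotient_topology {eq_quot orbit_equiv}).

HB.instance Definition _ := isPointed.Build suspension_top
  (\pi_{eq_quot orbit_equiv} (point, 0)).

(* The suspension, with its Borel sigma-algebra. *)
Definition suspension : Type := g_sigma_algebraType (@open suspension_top).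

HB.instance Definition _ :=
  Measurable.copy suspension (g_sigma_algebraType (@open suspension_top)).

Definition suspension_pi (u : subshift_type * R) : suspension :=
  \pi_{eq_quot orbit_equiv} u.

Definition suspension_repr (y : suspension) : subshift_type * R :=
  repr (y : {eq_quot orbit_equiv}).

(* flow_pi: the result does not depend on the representative. *)
Definition flow (t : R) (y : suspension) : suspension :=
  let: (x, s) := suspension_repr y in suspension_pi (x, s + t).

Lemma flow_pi t x s : flow t (suspension_pi (x, s)) = suspension_pi (x, s + t).
Proof.
rewrite /flow; set y := suspension_pi _; case E : (suspension_repr y) => [x' s'].
have /asboolP[n Hn] : orbit_rel (x', s') (x, s).
  by rewrite -E; apply/eqmodP; rewrite reprK.
have iter_flow m u r : iter m suspension_map (u.1, u.2 + r) =
    ((iter m suspension_map u).1, (iter m suspension_map u).2 + r).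
  by elim: m => //= m ->; rewrite /suspension_map /= addrAC.
apply/eqmodP/asboolP; exists n.
case: Hn => Hn; [left|right].
  by rewrite (iter_flow n (x', s')) Hn.
by rewrite (iter_flow n (x, s)) Hn.
Qed.

Definition letter_set (a : 'I_d) : set suspension :=
  suspension_pi @` [set u | val u.1 0 = a /\ 0 <= u.2 < p 0 (val u.1 0)].

Definition flow_invariant (mu : set suspension -> \bar R) :=
  forall t (B : set suspension), measurable B -> mu (flow t @^-1` B) = mu B.

End Suspension.

Section Spectral.
Context {R : realType}.

Definition Cintegral {disp} {X : measurableType disp}
    (mu : {measure set X -> \bar R}) (f : X -> R[i]) : R[i] :=
  Rintegral mu setT (fun x => complex.Re (f x)) +i*
  Rintegral mu setT (fun x => complex.Im (f x)).

Definition expi (x : R) : R[i] := cos x +i* sin x.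

Definition is_spectral_measure {disp} {X : measurableType disp}
    (mu : {measure set X -> \bar R}) (h : R -> X -> X) (f : X -> R[i])
    (nu : {measure set (measurableTypeR R) -> \bar R}) :=
  forall t : R, Cintegral nu (fun w => expi (2 * pi * t * w)) =
                Cintegral mu (fun x => f (h t x) * (f x)^*).

Definition is_correlation_measure {d : nat} (zeta : pa_substitution d)
    (p : 'rV[R]_d) (mu : {measure set (suspension zeta p) -> \bar R}) (a : 'I_d)
    (nu : {measure set (measurableTypeR R) -> \bar R}) :=
  is_spectral_measure mu (@flow _ zeta _ p)
    (fun x => (\1_(letter_set a) x)%:C) nu.

End Spectral.

(* Main.v *)
From HB Require Import structures.
Require Import Defs.
From mathcomp Require Import all_boot all_order all_algebra.
From mathcomp Require Import separable complex.
From mathcomp Require Import all_classical all_reals all_analysis.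
From mathcomp Require Import measurable_realfun.
From mathcomp Require Import ring lra zify.
Import numFieldNormedType.Exports.
Import Order.TTheory GRing.Theory Num.Theory.

Set Implicit Arguments.
Unset Strict Implicit.
Unset Printing Implicit Defensive.

Local Open Scope classical_set_scope.
Local Open Scope ring_scope.

(** Write e(t) = exp(2 i pi t).  Up to a constant, nu_a([omega - r, omega + r])
    is bounded by |S|^2 / N^2, where S is the sum over k < N of
    e(-omega k tau) 1_a(h_{k tau} y) and N tau is of order 1 / r.  When tau
    divides p_a and tends to 0, S reduces to the exponential sum Phi(w) of the
    e(-omega |u|_p) over the prefixes u of a word w of the subshift that are
    followed by a.  Cutting w into words zeta^n(b) with alpha^(2n) of order
    1 / r, it suffices to gain a factor exp(- g n) on Phi(zeta^n(b)).

    Fix a letter c and a word v such that c v c occurs in zeta^k(b) for all b,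
    and put kappa = |c v|_p.  The two copies of zeta^n(c) contribute two terms
    that differ by the factor e(-omega kappa alpha^n), so one gains the factor
    1 - const sin^2(pi omega kappa alpha^n) from zeta^n to zeta^(n+k).  It
    remains to bound below the density of the n for which
    x_n = omega kappa alpha^n is not close to an integer, in terms of A only.

    By the trace formula, x_n = t_n / L - y_n, where the integers t_n satisfy a
    linear recurrence, hence are periodic modulo L, and y_n is the sum of
    c_z z^n over the conjugates z of alpha other than alpha.  If the
    coefficients c_z with |z| = 1 are small, then x_n is close to t_n / L, which
    by (i) is not an integer at least once in every window of length d, because
    alpha is a unit.  Otherwise, by Dirichlet's theorem there is a period g of
    t modulo L for which the coefficients c_z (z^g - 1) of y_(n+g) - y_n are
    small but not too small: this needs only that no z is a root of unity.
    Then x_n and x_(n+g) cannot both be close to integers too often. *)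

(** * Trigonometric inequalities *)

Section Trigo.
Context {R : realType}.
Implicit Types x y : R.

Lemma cos_lipschitz x y : `|cos x - cos y| <= `|x - y|.
Proof.
wlog yx : x y / y <= x.
  move=> H; have [/H|/ltW/H] := leP y x => //.
  by rewrite distrC (distrC x).
have [c _ ->] : exists2 c, c \in `[y, x] & cos x - cos y = - sin c * (x - y).
  apply: (@MVT_segment _ _ (fun z => - sin z)) => //.
  exact/continuous_subspaceT/continuous_cos.
by rewrite normrM normrN ler_piMl// sin_max.
Qed.

Lemma abs_sin_le x : `|sin x| <= `|x|.
Proof.
have := cos_lipschitz (x - pi / 2) (0 - pi / 2).
rewrite !cosBpihalf sin0 subr0 (_ : x - pi / 2 - (0 - pi / 2) = x)//; ring.
Qed.

Lemma cos_ge_half x : `|x| <= 1 -> 2^-1 <= cos x.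
Proof.
move=> x1.
have -> : cos x = 1 - 2 * sin (x / 2) ^+ 2.
  rewrite {1}[x](_ : _ = x / 2 + x / 2); last by field.
  by rewrite cosD -!expr2 sin2cos2; ring.
have : sin (x / 2) ^+ 2 <= (2^-1) ^+ 2.
  rewrite -real_normK ?num_real// lerXn2r ?nnegrE//.
  rewrite (le_trans (abs_sin_le _))// normrM [`|2^-1|]ger0_norm ?invr_ge0//.
  by rewrite ler_piMl.
by rewrite expr2; lra.
Qed.

Lemma abs_sin_ge x : `|x| <= 1 -> `|x| / 2 <= `|sin x|.
Proof.
wlog x0 : x / 0 <= x.
  move=> H; case: (leP 0 x) => [/H//|/ltW x0]; rewrite -(normrN x) -(normrN (sin x)).
  by rewrite -sinN; apply: H; rewrite oppr_ge0.
rewrite ger0_norm// => x1.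
have [c cx] : exists2 c, c \in `[0, x] & sin x - sin 0 = cos c * (x - 0).
  apply: MVT_segment => //.
    exact/continuous_subspaceT/continuous_sin.
rewrite sin0 !subr0 => ->; rewrite normrM [`|x|]ger0_norm// mulrC ler_wpM2r//.
move: cx; rewrite in_itv/= => /andP[c0 cx].
by rewrite (le_trans _ (ler_norm _))// cos_ge_half// ger0_norm// (le_trans cx).
Qed.

(** This is 2 u <= 1 + u^2 for u = |cos x|. It turns the factor 2 |cos x| of two equal sums with
    phases 2 x apart into an explicit saving. *)
Lemma norm_cos_le x : 2 * `|cos x| <= 2 - sin x ^+ 2.
Proof.
rewrite sin2cos2 -(real_normK (num_real (cos x))).
by move: (sqr_ge0 (`|cos x| - 1)); rewrite !expr2; nra.
Qed.

(** Triangle inequality, up to a factor 2, for sin^2(pi x) as a measure of the squared distance from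
    x to the integers. *)
Lemma sin2D_le x y : sin (x + y) ^+ 2 <= 2 * sin x ^+ 2 + 2 * sin y ^+ 2.
Proof.
have h : `|sin (x + y)| <= `|sin x| + `|sin y|.
  rewrite sinD (le_trans (ler_normD _ _))// !normrM lerD//.
    by rewrite ler_piMr// cos_max.
  by rewrite ler_piMl// cos_max.
rewrite -!(real_normK (num_real (sin _))).
have : `|sin (x + y)| ^+ 2 <= (`|sin x| + `|sin y|) ^+ 2.
  by rewrite lerXn2r ?nnegrE// addr_ge0.
by move: (sqr_ge0 (`|sin x| - `|sin y|)); rewrite !expr2; nra.
Qed.

Lemma sin2_piDint x (k : int) : sin (pi * (x + k%:~R)) ^+ 2 = sin (pi * x) ^+ 2.
Proof.
have shift (u : R) : sin (u + pi) ^+ 2 = sin u ^+ 2.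
  by rewrite sinDpi sqrrN.
have nat (u : R) n : sin (pi * (u + n%:R)) ^+ 2 = sin (pi * u) ^+ 2.
  elim: n => [|n IH]; first by rewrite addr0.
  by rewrite -natr1 addrA mulrDr mulr1 shift.
case: k => n; first exact: nat.
by rewrite NegzE mulrNz -(nat (x - n.+1%:R) n.+1) subrK.
Qed.

End Trigo.

(** * Spectral measures of short intervals *)

Section FiniteMeasureIntegral.
Context {R : realType} {disp} {X : measurableType disp}.
Variable mu : {finite_measure set X -> \bar R}.

Lemma bounded_integrable (f : X -> R) (M : R) :
  measurable_fun setT f -> (forall x, `|f x| <= M) ->
  mu.-integrable setT (EFin \o f).
Proof.
move=> mf fM; apply: measurable_bounded_integrable => //.
  by rewrite ltey_eq fin_num_measure.
exists M; split; rewrite ?num_real// => y My x _.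
exact: le_trans (fM x) (ltW My).
Qed.

Lemma Rintegral_sum (I : Type) (s : seq I) (f : I -> X -> R) :
  (forall i, mu.-integrable setT (EFin \o f i)) ->
  \int[mu]_x (\sum_(i <- s) f i x) = \sum_(i <- s) \int[mu]_x f i x.
Proof.
move=> fi; elim: s => [|i s IH].
  rewrite big_nil; under eq_Rintegral do rewrite big_nil.
  by rewrite Rintegral_cst// mul0r.
rewrite big_cons -IH; under eq_Rintegral do rewrite big_cons.
rewrite RintegralD//.
have := @integrable_sum _ _ _ mu setT measurableT _ s xpredT
  (fun i => EFin \o f i) (fun i _ => fi i).
by apply: eq_integrable => // x _ /=; rewrite -sumEFin.
Qed.

Lemma Rintegral_indic (A : set X) : measurable A ->
  \int[mu]_x \1_A x = fine (mu A).
Proof. by move=> mA; rewrite /Rintegral integral_indic// setIT. Qed.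

End FiniteMeasureIntegral.

Section SpectralBound.
Context {R : realType} {disp} {X : measurableType disp}.
Variables (mu : probability X R) (h : R -> X -> X) (E : set X).
Variable nu : {finite_measure set (measurableTypeR R) -> \bar R}.
Hypothesis mE : measurable E.
Hypothesis mh : forall t, measurable_fun setT (h t).
Hypothesis hD : forall s t x, h s (h t x) = h (s + t) x.
Hypothesis h_inv : forall t B, measurable B -> mu (h t @^-1` B) = mu B.
Hypothesis nuE : is_spectral_measure mu h (fun x => (\1_E x)%:C%C) nu.

Let mhE t : measurable (h t @^-1` E).
Proof. by rewrite -[X in measurable X]setTI; exact: mh. Qed.

Let corr s t : fine (mu (h (s - t) @^-1` E `&` E)) =
  \int[mu]_x (\1_E (h s x) * \1_E (h t x)).
Proof.
have -> : (fun x => \1_E (h s x) * \1_E (h t x) : R) =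
    \1_(h s @^-1` E `&` h t @^-1` E).
  by apply/funext => x; rewrite !indicE in_setI -natrM mulnb.
rewrite Rintegral_indic; last exact: measurableI.
congr fine; rewrite -(h_inv t (measurableI _ _ (mhE (s - t)) mE)).
by congr (mu _); apply/seteqP; split => x /=; rewrite hD subrK.
Qed.

(** Real part of the spectral identity at time s - t; invariance under [h t] makes the correlation
    symmetric in s and t. *)
Lemma Rintegral_spectral_cos s t :
  \int[nu]_w cos (2 * pi * (s - t) * w) =
  \int[mu]_x (\1_E (h s x) * \1_E (h t x)).
Proof.
rewrite -corr; have [+ _] := nuE (s - t); rewrite /expi/= => ->.
rewrite -Rintegral_indic; last exact: measurableI.
apply: eq_Rintegral => x _.
by rewrite /= mul0r subr0 !indicE in_setI -natrM mulnb.
Qed.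

Lemma Rintegral_spectral_sin t : \int[nu]_w sin (2 * pi * t * w) = 0.
Proof.
have [_] := nuE t; rewrite /expi/= => ->.
under eq_Rintegral do rewrite mul0r oppr0 mulr0 addr0.
by rewrite Rintegral_cst// mul0r.
Qed.

Let mtrig (f : R -> R) c : continuous f ->
  measurable_fun setT (fun w : measurableTypeR R => f (c * w)).
Proof.
move=> fc; apply: measurableT_comp; first exact: continuous_measurable_fun.
exact: mulrl_measurable.
Qed.

Let mF t : measurable_fun setT (fun x => \1_E (h t x) : R).
Proof. by apply: measurableT_comp; [exact: measurable_indic|exact: mh]. Qed.

Let mFF s t : mu.-integrable setT (EFin \o (fun x => \1_E (h s x) * \1_E (h t x))).
Proof.
apply: (@bounded_integrable _ _ _ _ _ 1); first exact: measurable_funM (mF s) (mF t).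
by move=> x; rewrite !indicE -natrM mulnb; case: andb; rewrite ?normr1 ?normr0.
Qed.

(** Both sides are the squared modulus of the sum of F_k exp(i a_k). *)
Lemma sum_cosB (n : nat) (F a : 'I_n -> R) :
  \sum_k \sum_l cos (a k - a l) * (F k * F l) =
  (\sum_k F k * cos (a k)) ^+ 2 + (\sum_k F k * sin (a k)) ^+ 2.
Proof.
rewrite !expr2 !mulr_suml -big_split/=; apply: eq_bigr => k _.
rewrite !mulr_sumr -big_split/=; apply: eq_bigr => l _.
by rewrite cosB; ring.
Qed.

(** The kernel [K] w = |sum of e(t_k (w - omega))|^2 is integrated against [nu]. It is nonnegative,
    and at least n^2 / 2 on the interval; its integral is that of |sum of F_k e(omega t_k)|^2
    against [mu], at most 2 B^2. *)
Lemma spectral_interval_bound (n : nat) (tau omega r B : R) :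
    (0 < n)%N -> 0 <= tau -> 0 <= r -> 2 * pi * (n%:R * tau) * r <= 1 ->
    (forall x phi, \sum_(k < n) \1_E (h (k%:R * tau) x) *
                     cos (2 * pi * omega * (k%:R * tau) + phi) <= B) ->
  (nu `[(omega - r)%R, (omega + r)%R]%classic <= (4 * B ^+ 2 / n%:R ^+ 2)%:E)%E.
Proof.
move=> n0 tau0 r0 nr FB.
pose t (k : 'I_n) : R := k%:R * tau.
pose F (k : 'I_n) x : R := \1_E (h (t k) x).
pose K w := \sum_k \sum_l cos (2 * pi * (t k - t l) * (w - omega)).
have KE w : K w = \sum_k \sum_l
    (cos (2 * pi * (t k - t l) * omega) * cos (2 * pi * (t k - t l) * w) +
     sin (2 * pi * (t k - t l) * omega) * sin (2 * pi * (t k - t l) * w)).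
  apply: eq_bigr => k _; apply: eq_bigr => l _.
  by rewrite mulrBr cosB; ring.
have icos c d : nu.-integrable setT (EFin \o (fun w => c * cos (d * w))).
  apply: (@bounded_integrable _ _ _ _ _ `|c|).
    by apply: measurable_funM => //; apply: mtrig; exact: continuous_cos.
  by move=> w; rewrite normrM ler_piMr// cos_max.
have isin c d : nu.-integrable setT (EFin \o (fun w => c * sin (d * w))).
  apply: (@bounded_integrable _ _ _ _ _ `|c|).
    by apply: measurable_funM => //; apply: mtrig; exact: continuous_sin.
  by move=> w; rewrite normrM ler_piMr// sin_max.
have iterm k l : nu.-integrable setT (EFin \o (fun w =>
    (cos (2 * pi * (t k - t l) * omega) * cos (2 * pi * (t k - t l) * w) +
     sin (2 * pi * (t k - t l) * omega) * sin (2 * pi * (t k - t l) * w)))).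
  exact: (integrableD measurableT (icos _ _) (isin _ _)).
have iK : nu.-integrable setT (EFin \o K).
  have -> : EFin \o K = (fun w => \sum_k \sum_l (
    (cos (2 * pi * (t k - t l) * omega) * cos (2 * pi * (t k - t l) * w) +
     sin (2 * pi * (t k - t l) * omega) * sin (2 * pi * (t k - t l) * w))%:E))%E.
    apply/funext => w /=; rewrite KE -sumEFin.
    by apply: eq_bigr => k _; rewrite -sumEFin.
  apply: integrable_sum; first exact: measurableT.
  move=> k _; apply: integrable_sum; first exact: measurableT.
  by move=> l _; exact: iterm.
have intK : \int[nu]_w K w <= 2 * B ^+ 2.
  have -> : \int[nu]_w K w = \int[mu]_x
      (\sum_k \sum_l cos (2 * pi * omega * t k - 2 * pi * omega * t l) * (F k x * F l x)).
    under eq_Rintegral do rewrite KE.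
    rewrite Rintegral_sum; last first.
      move=> k; have := @integrable_sum _ _ _ nu setT measurableT _
        (index_enum 'I_n) xpredT _ (fun l _ => iterm k l).
      by apply: eq_integrable => // w _ /=; rewrite -sumEFin.
    have iFF k l : mu.-integrable setT (EFin \o (fun x =>
        cos (2 * pi * omega * t k - 2 * pi * omega * t l) * (F k x * F l x))).
      exact: (integrableZl measurableT _ (mFF _ _)).
    rewrite Rintegral_sum; last first.
      move=> k; have := @integrable_sum _ _ _ mu setT measurableT _
        (index_enum 'I_n) xpredT _ (fun l _ => iFF k l).
      by apply: eq_integrable => // w _ /=; rewrite -sumEFin.
    apply: eq_bigr => k _; rewrite !Rintegral_sum//.
    apply: eq_bigr => l _.
    have i1 d : nu.-integrable setT (EFin \o (fun w => cos (d * w))).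
      by have := icos 1 d; apply: eq_integrable => // w _ /=; rewrite mul1r.
    have i2 d : nu.-integrable setT (EFin \o (fun w => sin (d * w))).
      by have := isin 1 d; apply: eq_integrable => // w _ /=; rewrite mul1r.
    rewrite RintegralD// !RintegralZl//; last exact: mFF.
    transitivity (cos (2 * pi * (t k - t l) * omega) *
        \int[mu]_x (F k x * F l x) + sin (2 * pi * (t k - t l) * omega) * 0).
      congr (_ * _ + _ * _); first exact: Rintegral_spectral_cos.
      exact: Rintegral_spectral_sin.
    by rewrite mulr0 addr0; congr (cos _ * _); ring.
  have Kle x : \sum_k \sum_l
      cos (2 * pi * omega * t k - 2 * pi * omega * t l) * (F k x * F l x) <=
      2 * B ^+ 2.
    rewrite (sum_cosB (fun k => F k x) (fun k => 2 * pi * omega * t k)).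
    (* The free phase gives both signs of the real part (pi and 0), then of the imaginary part (pi /
       2 and - pi / 2). *)
    have c1 : `|\sum_k F k x * cos (2 * pi * omega * t k)| <= B.
      rewrite ler_norml; apply/andP; split.
        have := FB x pi; rewrite lerNl -sumrN; congr (_ <= _); apply: eq_bigr => k _.
        by rewrite cosDpi mulrN.
      by have := FB x 0; congr (_ <= _); apply: eq_bigr => k _; rewrite addr0.
    have c2 : `|\sum_k F k x * sin (2 * pi * omega * t k)| <= B.
      rewrite ler_norml; apply/andP; split.
        have := FB x (pi / 2); rewrite lerNl -sumrN; congr (_ <= _); apply: eq_bigr => k _.
        by rewrite cosDpihalf mulrN.
      by have := FB x (- (pi / 2)); congr (_ <= _); apply: eq_bigr => k _; rewrite cosBpihalf.
    have sq (u : R) : `|u| <= B -> u ^+ 2 <= B ^+ 2.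
      by move=> uB; rewrite -(real_normK (num_real u)) lerXn2r ?nnegrE// (le_trans _ uB).
    by rewrite (_ : 2 * B ^+ 2 = B ^+ 2 + B ^+ 2); [rewrite lerD// sq|ring].
  have iFF : mu.-integrable setT (EFin \o (fun x => \sum_k \sum_l
      cos (2 * pi * omega * t k - 2 * pi * omega * t l) * (F k x * F l x))).
    have -> : EFin \o (fun x => \sum_k \sum_l
        cos (2 * pi * omega * t k - 2 * pi * omega * t l) * (F k x * F l x)) =
      (fun x => \sum_k \sum_l
        (cos (2 * pi * omega * t k - 2 * pi * omega * t l) * (F k x * F l x))%:E)%E.
      by apply/funext => x /=; rewrite -sumEFin; apply: eq_bigr => k _; rewrite -sumEFin.
    apply: integrable_sum; first exact: measurableT.
    move=> k _; apply: integrable_sum; first exact: measurableT.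
    move=> l _; exact: (integrableZl measurableT _ (mFF _ _)).
  apply: (@le_trans _ _ (\int[mu]_x (2 * B ^+ 2))).
    by apply: le_Rintegral => //; exact: finite_measure_integrable_cst.
  by rewrite Rintegral_cst//= probability_setT mulr1.
set I := `[_, _]%classic.
have mI : measurable (I : set (measurableTypeR R)) by exact: measurable_itv.
have KI w : n%:R ^+ 2 / 2 * \1_I w <= K w.
  rewrite indicE; case: (boolP (w \in I)) => wI; last first.
    rewrite mulr0 /K.
    have := sum_cosB (fun=> 1) (fun k => 2 * pi * t k * (w - omega)).
    under eq_bigr do under eq_bigr do rewrite !mulr1 -mulrBl -mulrBr.
    by move=> ->; rewrite addr_ge0// sqr_ge0.
  (* On the interval all n^2 cosines have arguments of modulus at most 1, hence are at least 1/2. *)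
  rewrite mulr1 /K.
  have -> : n%:R ^+ 2 / 2 = \sum_(k < n) \sum_(l < n) (2^-1 : R).
    by rewrite !sumr_const !card_ord -(mulr_natr _ n) -(mulr_natr _ n); ring.
  apply: ler_sum => k _; apply: ler_sum => l _; apply: cos_ge_half.
  apply: le_trans nr.
  have wr : `|w - omega| <= r.
    by move: wI; rewrite inE /I/= in_itv/= ler_distl.
  rewrite !normrM; apply: ler_pM => //; rewrite ?mulr_ge0//.
  rewrite normr_nat (ger0_norm (pi_ge0 R)) ler_wpM2l ?mulr_ge0 ?pi_ge0//.
  have tn j : 0 <= t j <= n%:R * tau.
    by rewrite /t mulr_ge0//= ler_wpM2r// ler_nat ltnW.
  by have := tn k; have := tn l; rewrite ler_norml; lra.
have : n%:R ^+ 2 / 2 * fine (nu I) <= 2 * B ^+ 2.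
  rewrite -Rintegral_indic// -RintegralZl//; last exact: integrable_indic.
  apply: le_trans intK; apply: le_Rintegral => //.
  exact: (integrableZl measurableT _ (integrable_indic nu mI)).
rewrite -[nu I]fineK ?fin_num_measure// lee_fin.
have n2 : 0 < n%:R ^+ 2 :> R by rewrite exprn_gt0// ltr0n.
by rewrite ler_pdivlMr//; lra.
Qed.

End SpectralBound.

(** * The suspension flow *)

Section ShiftTopology.
Context {d : nat} (zeta : pa_substitution d).
Local Notation X := (subshift_type zeta).

Lemma coord_continuous (i : int) :
  continuous (fun x : X => (val x : fullshift d) i : discrete_topology 'I_d).
Proof.
move=> x; apply: (@continuous_comp _ _ _ (val : X -> fullshift d)
  (fun y : fullshift d => y i : discrete_topology 'I_d)).
  exact: initial_continuous.
exact: (@proj_continuous _ (fun _ : int => discrete_topology 'I_d) i).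
Qed.

Lemma near_coord (x : X) (i : int) : \forall y \near x, val y i = val x i.
Proof. exact: (coord_continuous (discrete_set1 (val x i : discrete_topology 'I_d))). Qed.

(** The topology is induced by a product of discrete spaces, so continuity means that each
    coordinate is locally constant. *)
Lemma to_subshift_continuous (T : topologicalType) (f : T -> X) :
  (forall t i, \forall s \near t, val (f s) i = val (f t) i) -> continuous f.
Proof.
move=> cf; apply: continuous_comp_initial => t.
apply/cvg_sup => i.
apply: (@continuous_comp_initial _ _ _
  (fun g : fullshift d => g i : discrete_topology 'I_d)
  (fun s => val (f s))) => {}t.
apply/discrete_cvg; exact: cf.
Qed.

End ShiftTopology.

Section FlowMeasurability.
Local Open Scope quotient_scope.
Context {d : nat} (zeta : pa_substitution d) {R : realType} (p : 'rV[R]_d).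
Hypothesis p_gt0 : forall a, 0 < p 0 a.
Local Notation X := (subshift_type zeta).
Local Notation F := (@suspension_map d zeta R p).
Local Notation pi := (@suspension_pi d zeta R p).

Lemma right_shift_subshift (x : fullshift d) :
  subshift zeta x -> subshift zeta (fun n => x (n - 1)).
Proof.
move=> xX i k; have [a [n xa]] := xX (i - 1) k; exists a, n.
rewrite (_ : block _ i k = block x (i - 1) k)//.
by apply: eq_map => j; rewrite addrAC.
Qed.

Definition subshift_inv (x : X) : X :=
  exist _ (fun n => val x (n - 1) : 'I_d)
    (mem_set (right_shift_subshift (set_mem (valP x)))).

Lemma subshift_invK : cancel subshift_inv (@subshift_map d zeta).
Proof.
move=> x; apply: val_inj; apply/funext => n /=.
by rewrite /left_shift addrK.
Qed.

Definition suspension_inv (u : X * R) : X * R :=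
  (subshift_inv u.1, u.2 + p 0 (val u.1 (-1))).

Lemma suspension_invK : cancel suspension_inv F.
Proof.
move=> [x s]; rewrite /suspension_inv /suspension_map /= subshift_invK.
by rewrite sub0r addrK.
Qed.

Let near_fst (u : X * R) i : \forall v \near u, val v.1 i = val u.1 i.
Proof.
exact: (@cvg_fst _ _ (nbhs u.1) (nbhs u.2) _ _ (near_coord u.1 i)).
Qed.

Let near_letter (u : X * R) i (g : 'I_d -> R) :
  {for u, continuous (fun v : X * R => g (val v.1 i))}.
Proof.
apply/cvgrPdist_lt => e e0; near=> v.
by rewrite (near (near_fst u i) v)// subrr normr0.
Unshelve. all: by end_near. Qed.

Lemma suspension_map_continuous : continuous F.
Proof.
move=> u; apply: (@cvg_pair _ _ _ (nbhs u) (nbhs (F u).1) (nbhs (F u).2) _ _ _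
   (fun v => (F v).1) (fun v => (F v).2)).
  apply: (@to_subshift_continuous _ zeta _ (fun v => (F v).1)) => v i.
  exact: near_fst.
apply: (@cvgB _ _ _ (nbhs u)); first exact: cvg_snd.
exact: (@near_letter u 0 (fun a => p 0 a)).
Qed.

Lemma suspension_inv_continuous : continuous suspension_inv.
Proof.
move=> u; apply: (@cvg_pair _ _ _ (nbhs u) (nbhs (suspension_inv u).1) (nbhs (suspension_inv u).2) _ _ _
   (fun v => (suspension_inv v).1) (fun v => (suspension_inv v).2)).
  apply: (@to_subshift_continuous _ zeta _ (fun v => (suspension_inv v).1)) => v i.
  exact: near_fst.
apply: (@cvgD _ _ _ (nbhs u)); first exact: cvg_snd.
exact: (@near_letter u (-1) (fun a => p 0 a)).
Qed.

Lemma orbit_relP u v : orbit_rel p u v <->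
  exists n, iter n F u = v \/ iter n suspension_inv u = v.
Proof.
have iterK n w : iter n F (iter n suspension_inv w) = w.
  by elim: n w => // n IH w; rewrite [iter _ suspension_inv w]iterS iterSr suspension_invK.
have iterI n : injective (iter n F).
  by elim: n => [|n IHn] // w w' /suspension_map_inj/IHn.
rewrite /orbit_rel; split=> [/asboolP[n [H|H]]|[n [H|H]]].
- by exists n; left.
- by exists n; right; apply: (iterI n); rewrite iterK.
- by apply/asboolP; exists n; left.
- by apply/asboolP; exists n; right; rewrite -H iterK.
Qed.

Lemma suspension_piP u v : pi u = pi v <-> orbit_rel p u v.
Proof. by split => [/eqmodP|H]; [|apply/eqmodP]. Qed.

(** The saturation of V is the union of its preimages under the iterates of [suspension_map] and of
    its inverse, all continuous. *)
Lemma suspension_pi_open (V : set (X * R)) :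
  open V -> open (pi @` V : set (suspension_top zeta p)).
Proof.
move=> oV; rewrite /open/= /quotient_open.
have iter_cont (f : X * R -> X * R) n : continuous f -> continuous (iter n f).
  move=> cf; elim: n => [|n IH] u; first exact: cvg_id.
  by apply: (@continuous_comp _ _ _ (iter n f) f); [exact: IH|exact: cf].
rewrite (_ : _ @^-1` _ = (\bigcup_n (iter n F @^-1` V)) `|`
                         (\bigcup_n (iter n suspension_inv @^-1` V))).
  apply: openU; apply: bigcup_open => n _; apply: open_comp => // u _.
    exact/iter_cont/suspension_map_continuous.
  exact/iter_cont/suspension_inv_continuous.
apply/seteqP; split => [u [v Vv /esym/suspension_piP/orbit_relP[n [H|H]]]|u].
- by left; exists n => //=; rewrite H.
- by right; exists n => //=; rewrite H.
- by move=> [[n _ /= Vn]|[n _ /= Vn]]; eexists; try exact: Vn;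
    apply/esym/suspension_piP/orbit_relP; exists n; [left|right].
Qed.

Lemma suspension_piW (y : suspension zeta p) : exists u, y = pi u.
Proof. by exists (suspension_repr y); rewrite /suspension_pi reprK. Qed.

Lemma flowD s t (y : suspension zeta p) : flow s (flow t y) = flow (s + t) y.
Proof.
by have [[x r] ->] := suspension_piW y; rewrite !flow_pi -addrA (addrC t).
Qed.

Lemma measurable_flow t : measurable_fun setT (@flow d zeta R p t).
Proof.
apply: measurability => //= _ [U oU <-]; rewrite setTI.
apply: sub_sigma_algebra; rewrite /open/= /quotient_open.
rewrite (_ : _ @^-1` _ = (fun u : X * R => (u.1, u.2 + t)) @^-1` (pi @^-1` U)).
  apply: open_comp => // u _.
  apply: (@cvg_pair _ _ _ (nbhs u) (nbhs u.1) (nbhs (u.2 + t)) _ _ _ fst (fun u => u.2 + t)).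
    exact: cvg_fst.
  by apply: cvgD; [exact: cvg_snd|exact: cvg_cst].
by apply/seteqP; split => -[x s] /=; rewrite -[\pi_ _ _]/(pi (x, s)) flow_pi.
Qed.

Lemma min_entry : exists2 m : R, 0 < m & forall a, m <= p 0 a.
Proof.
exists (\big[Order.min/1]_a p 0 a); last by move=> a; exact: bigmin_le_cond.
by apply: lt_bigmin => //.
Qed.

Lemma iter_suspension_map_le n u : (iter n F u).2 <= u.2.
Proof.
elim: n => // n IH; rewrite iterS (le_trans _ IH)// gerBl.
exact: ltW.
Qed.

(** [suspension_map] lowers the time, and makes it negative from the fundamental domain on: no
    positive iterate comes back to the domain. *)
Lemma fundamental_domain_inj (u v : X * R) :
  0 <= u.2 < p 0 (val u.1 0) -> 0 <= v.2 < p 0 (val v.1 0) ->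
  pi u = pi v -> u = v.
Proof.
have aux w n : w.2 < p 0 (val w.1 0) -> (iter n.+1 F w).2 < 0.
  move=> wlt; rewrite iterSr (le_lt_trans (iter_suspension_map_le _ _))//=.
  by rewrite subr_lt0.
move=> /andP[u0 up] /andP[v0 vp] /suspension_piP/asboolP[[|n] [uv|vu]] //.
- by move: (aux u n up); rewrite uv ltNge v0.
- by move: (aux v n vp); rewrite vu ltNge u0.
Qed.

(** Induction on N with |s| <= N m: unless the domain is reached, one application of the map or of
    its inverse lowers |s| by at least m. *)
Lemma fundamental_domain_surj (y : suspension zeta p) :
  exists u, y = pi u /\ 0 <= u.2 < p 0 (val u.1 0).
Proof.
have [[x s] ->] := suspension_piW y.
have [m m0 mp] := min_entry.
pose N := Num.trunc (`|s| / m).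
have : `|s| <= N.+1%:R * m by rewrite -ler_pdivrMr// ltW// truncnS_gt.
move: N.+1 => {N} N; elim: N x s => [|n IH] x s.
  rewrite mul0r normr_le0 => /eqP ->; exists (x, 0); split => //=.
  by rewrite lexx p_gt0.
rewrite -natr1 mulrDl mul1r => sn.
have [s0|s0] := leP 0 s.
  have [sp|sp] := ltP s (p 0 (val x 0)); first by exists (x, s); rewrite s0 sp.
  rewrite (_ : pi (x, s) = pi (F (x, s))); last first.
    by apply/suspension_piP/orbit_relP; exists 1%N; left.
  rewrite /suspension_map/=; set q := p 0 _ in sp *.
  apply: IH; rewrite ger0_norm ?subr_ge0//.
  by rewrite ger0_norm// in sn; have := mp (val x 0); rewrite -/q; lra.
rewrite (_ : pi (x, s) = pi (suspension_inv (x, s))); last first.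
  by apply/suspension_piP/orbit_relP; exists 1%N; right.
rewrite /suspension_inv/=; set q := p 0 _.
have [sq|sq] := leP 0 (s + q).
  exists (subshift_inv x, s + q); split => //=; rewrite sq sub0r/=.
  by rewrite -/q gtrDr.
apply: IH; rewrite ltr0_norm//.
by move: sn (mp (val x (-1))); rewrite ltr0_norm// -/q; lra.
Qed.

Let open_strip (a : 'I_d) (c e : R) :
  open [set u : X * R | val u.1 0 = a /\ c < u.2 < e].
Proof.
rewrite openE => -[x s] [/= xa cse]; rewrite /interior/=.
exists ([set x' | val x' 0 = a], `]c, e[%classic) => /=; last first.
  by move=> [x' s'] [/= -> ]; rewrite in_itv.
split; last by apply: open_nbhs_nbhs; split => //=; rewrite in_itv.
by rewrite -xa; exact: near_coord.
Qed.

(* The points at the left end of a tile a are those of the open set O that lie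
   in the interior Lo b of no tile. *)
Lemma measurable_letter_set (a : 'I_d) : measurable (@letter_set d zeta R p a).
Proof.
have [m m0 mp] := min_entry.
pose Lo b := pi @` [set u : X * R | val u.1 0 = b /\ 0 < u.2 < p 0 b].
pose O := pi @` [set u : X * R | val u.1 0 = a /\ - m < u.2 < m].
have oM (V : set (X * R)) : open V -> measurable (pi @` V).
  by move=> oV; apply: sub_sigma_algebra; exact: suspension_pi_open.
have -> : @letter_set d zeta R p a = Lo a `|` (O `\` \bigcup_b Lo b).
  apply/seteqP; split => y.
    move=> [[x s] /= [xa /andP[s0 sp]] <-].
    have [sgt0|sle0] := ltP 0 s.
      by left; exists (x, s) => //=; rewrite sgt0 -xa.
    have {sle0 s0}-> : s = 0 by apply/le_anti/andP.
    right; split.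
      by exists (x, 0) => //=; rewrite oppr_lt0 m0.
    move=> [b _ [[x' s'] /= [x'b /andP[s'0 s'p]]]] E.
    have : (x', s') = (x, 0).
      by apply: fundamental_domain_inj => //=; rewrite ?lexx ?p_gt0// x'b ltW.
    by move=> [_ s'E]; rewrite s'E ltxx in s'0.
  move=> [[[x s] /= [xa /andP[s0 sp]] <-]|[[[x s] /= [xa /andP[ms sm]] <-] nL]].
    by exists (x, s) => //=; rewrite xa (ltW s0) sp.
  have [s0|] := ltP 0 s.
    by case: nL; exists a => //; exists (x, s) => //=; rewrite s0 (lt_le_trans sm).
  rewrite le_eqVlt => /predU1P[->|s0].
    by exists (x, 0) => //=; rewrite lexx p_gt0.
  (* A time between - m and 0 lies inside the preceding tile, whose length is at least m. *)
  case: nL; exists (val x (-1)) => //; exists (suspension_inv (x, s)).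
    rewrite /= sub0r; split => //.
    by move: (mp (val x (-1))); lra.
  by apply/esym/suspension_piP/orbit_relP; exists 1%N; right.
apply: measurableU; first by apply: oM; exact: (@open_strip a 0 (p 0 a)).
apply: measurableD; first by apply: oM; exact: (@open_strip a (- m) m).
apply: fin_bigcup_measurable => [|b _]; first exact: finite_finset.
by apply: oM; exact: (@open_strip b 0 (p 0 b)).
Qed.

(** Time at which the flow from (x, 0) enters the tile of the letter x_i. *)
Definition tile_start (x : X) (i : nat) : R := \sum_(j < i) p 0 (val x j%:Z).

Lemma tile_startS x i :
  tile_start x i.+1 = tile_start x i + p 0 (val x i%:Z).
Proof. by rewrite /tile_start big_ord_recr. Qed.

Lemma indic_letter_set_tile (a : 'I_d) x s i :
  tile_start x i <= s < tile_start x i.+1 ->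
  \1_(@letter_set d zeta R p a) (pi (x, s)) = (val x i%:Z == a)%:R :> R.
Proof.
have iterF n u : (iter n F u).2 = u.2 - tile_start u.1 n /\
    forall k, val (iter n F u).1 k = val u.1 (k + n%:Z).
  elim: n => [|n [IH1 IH2]].
    by split => [|k]; rewrite /= ?/tile_start ?big_ord0 ?subr0 ?addr0.
  split => [|k] /=; first by rewrite IH1 IH2 add0r tile_startS opprD addrA.
  by rewrite /left_shift IH2 intS addrA.
have [] := iterF i (x, s); set v := iter i F (x, s) => v2 v1.
have -> : pi (x, s) = pi v by apply/suspension_piP/orbit_relP; exists i; left.
have v10 : val v.1 0 = val x i%:Z by rewrite v1 add0r.
rewrite tile_startS => /andP[s1 s2]; rewrite indicE; congr ((nat_of_bool _)%:R).
have vdom : 0 <= v.2 < p 0 (val v.1 0).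
  by rewrite v2 v10 subr_ge0 s1 ltrBlDl.
apply/idP/eqP => [|xa]; last first.
  by rewrite inE; exists v => //; split => //; rewrite -xa; exact: v10.
rewrite inE => -[w [wa wdom]] /(fundamental_domain_inj wdom vdom) wv.
by rewrite -wa wv; exact: esym v10.
Qed.

End FlowMeasurability.

(** * Twisted sums over words *)

Section Words.
Context {d : nat} (zeta : substitution d).
Local Notation subst n := (iter n (subst_word zeta)).
Implicit Types (u v w : seq 'I_d).

Lemma subst_word_cat u v :
  subst_word zeta (u ++ v) = subst_word zeta u ++ subst_word zeta v.
Proof. by rewrite /subst_word map_cat flatten_cat. Qed.

Lemma iter_subst_cat n u v : subst n (u ++ v) = subst n u ++ subst n v.
Proof. by elim: n => // n IH; rewrite !iterS IH subst_word_cat. Qed.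

Lemma iter_subst_cons n b w : subst n (b :: w) = subst n [:: b] ++ subst n w.
Proof. by rewrite -cat1s iter_subst_cat. Qed.

Lemma iter_subst_flatten n w :
  subst n w = flatten [seq subst n [:: b] | b <- w].
Proof.
elim: w => [|b w IH]; last by rewrite iter_subst_cons IH.
by elim: n => // n; rewrite iterS => ->.
Qed.

Lemma count_subst_word b w :
  count_mem b (subst_word zeta w) = (\sum_(c <- w) subst_mx zeta b c)%N.
Proof.
rewrite /subst_word count_flatten -map_comp sumnE big_map.
by apply: eq_bigr => c _; rewrite mxE.
Qed.

Lemma sum_count_mem (F : 'I_d -> nat) w :
  (\sum_(c <- w) F c = \sum_j F j * count_mem j w)%N.
Proof.
elim: w => [|c w IH]; first by rewrite big_nil big1// => j _; rewrite muln0.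
rewrite big_cons IH.
under [RHS]eq_bigr do rewrite /= mulnDr.
rewrite big_split/=; congr addn.
rewrite (bigD1 c)//= eqxx muln1 big1 ?addn0// => j jc.
by rewrite eq_sym (negbTE jc) muln0.
Qed.

Lemma count_iter_subst n b c :
  count_mem b (subst n [:: c]) = (subst_mx zeta ^+ n) b c.
Proof.
elim: n b => [|n IH] b; first by rewrite expr0 mxE /= addn0 eq_sym; case: eqP.
rewrite iterS count_subst_word exprS mxE sum_count_mem.
by apply: eq_bigr => j _; rewrite IH.
Qed.

Lemma count_mem_ge2 (c : 'I_d) s : (2 <= count_mem c s)%N ->
  exists u v w, s = u ++ c :: v ++ c :: w.
Proof.
elim: s => // b s IH /=; case: eqP => [->|_]; last first.
  by rewrite add0n => /IH[u [v [w ->]]]; exists (b :: u), v, w.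
rewrite add1n ltnS -has_count has_pred1 => /splitPr[v w].
by exists [::], v, w.
Qed.

(* Iterating the positive power once more plants the same repeated letter,
   with the same word in between, inside the image of every letter. *)
Lemma common_return_word : (2 <= d)%N -> primitive_mx (subst_mx zeta) ->
  exists (c : 'I_d) v k, (0 < k)%N /\
    forall b, exists u w, subst k [:: b] = u ++ c :: v ++ c :: w.
Proof.
move=> d2 [k k0 Mk]; have d0 : (0 < d)%N by exact: leq_trans d2.
pose c : 'I_d := Ordinal d0.
have [u [v [w uvw]]] : exists u v w,
    subst (k + k) [:: c] = u ++ c :: v ++ c :: w.
  (* The diagonal entry of the power k + k is a sum of d >= 2 products of positive entries. *)
  apply: count_mem_ge2; rewrite count_iter_subst exprD mxE.
  rewrite -[X in (_ <= X)%N]/(\sum_j (subst_mx zeta ^+ k) c j * (subst_mx zeta ^+ k) j c)%N.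
  apply: (@leq_trans (\sum_(j < d) 1)%N); first by rewrite sum1_card card_ord.
  by apply: leq_sum => j _; rewrite muln_gt0 !Mk.
exists c, v, (k + k + k)%N; split=> [|b]; first by rewrite addn_gt0 k0 orbT.
have : c \in subst k [:: b].
  by rewrite -has_pred1 has_count count_iter_subst Mk.
rewrite iterD => /splitPr[u' w'].
rewrite iter_subst_cat iter_subst_cons uvw.
exists (subst (k + k) u' ++ u), (w ++ subst (k + k) w').
by rewrite -!catA /= -!catA.
Qed.

End Words.

Section TwistedSums.
Context {R : realType} {d : nat} (zeta : substitution d).
Local Notation subst n := (iter n (subst_word zeta)).
Implicit Types (u v w : seq 'I_d).
Variables (p : 'rV[R]_d) (alpha : R).
Hypothesis p_gt0 : forall a, 0 < p 0 a.
Hypothesis alpha_gt1 : 1 < alpha.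
Hypothesis p_eigen : p *m map_mx (fun n => n%:R : R) (subst_mx zeta) = alpha *: p.

(** The length |w|_p: the time the flow takes to cross the tiles of w. *)
Definition wlen w : R := \sum_(b <- w) p 0 b.

Lemma wlen_cat u v : wlen (u ++ v) = wlen u + wlen v.
Proof. by rewrite /wlen big_cat. Qed.

Lemma wlen_cons b w : wlen (b :: w) = p 0 b + wlen w.
Proof. by rewrite /wlen big_cons. Qed.

Lemma wlen1 b : wlen [:: b] = p 0 b.
Proof. by rewrite /wlen big_seq1. Qed.

Lemma wlen_ge0 w : 0 <= wlen w.
Proof. by apply: sumr_ge0 => b _; exact: ltW. Qed.

Lemma wlenE w : wlen w = \sum_j p 0 j * (count_mem j w)%:R.
Proof.
elim: w => [|c w IH]; first by rewrite /wlen big_nil big1// => j _; rewrite mulr0.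
rewrite wlen_cons IH; under [RHS]eq_bigr do rewrite /= natrD mulrDr.
rewrite big_split/=; congr (_ + _).
rewrite (bigD1 c)//= eqxx mulr1 big1 ?addr0// => j jc.
by rewrite eq_sym (negbTE jc) mulr0.
Qed.

Lemma wlen_subst_word w : wlen (subst_word zeta w) = alpha * wlen w.
Proof.
elim: w => [|b w IH]; first by rewrite /wlen !big_nil mulr0.
rewrite -cat1s subst_word_cat wlen_cat [in RHS]wlen_cat IH mulrDr; congr (_ + _).
rewrite wlen1 wlenE.
have := congr1 (fun M : 'rV_d => M 0 b) p_eigen; rewrite !mxE => <-.
by apply: eq_bigr => j _; rewrite count_subst_word big_seq1 !mxE.
Qed.

Lemma wlen_iter_subst n w : wlen (subst n w) = alpha ^+ n * wlen w.
Proof.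
elim: n => [|n IH]; first by rewrite expr0 mul1r.
by rewrite iterS wlen_subst_word IH exprS mulrA.
Qed.

Variables (m M : R).
Hypothesis m_gt0 : 0 < m.
Hypothesis m_le : forall b, m <= p 0 b.
Hypothesis M_ge : forall b, p 0 b <= M.

Lemma size_le_wlen w : (size w)%:R * m <= wlen w.
Proof.
elim: w => [|b w IH]; first by rewrite mul0r wlen_ge0.
by rewrite wlen_cons /= -natr1 mulrDl mul1r addrC lerD.
Qed.

Section Fixed.
Variables (omega : R) (a : 'I_d).

(** Real part of exp(- i phi) Phi(w). The free phase replaces complex sums: a bound valid for all
    phi is a bound on |Phi(w)|. *)
Fixpoint twisted w (phi : R) : R :=
  if w is b :: w' then
    (b == a)%:R * cos phi + twisted w' (phi + 2 * pi * omega * p 0 b)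
  else 0.

Lemma twisted_cat u v phi :
  twisted (u ++ v) phi = twisted u phi + twisted v (phi + 2 * pi * omega * wlen u).
Proof.
elim: u phi => [|b u IH] phi /=; first by rewrite /wlen big_nil mulr0 addr0 add0r.
by rewrite IH wlen_cons (mulrDr (2 * pi * omega)) (addrA phi) addrA.
Qed.

Lemma twisted_le_size w phi : twisted w phi <= (size w)%:R.
Proof.
elim: w phi => [|b w IH] phi //=; rewrite -[(size w).+1%:R]nat1r lerD//.
have c1 : cos phi <= 1 by rewrite (le_trans (ler_norm _))// cos_max.
by case: eqP; rewrite ?mul1r// mul0r.
Qed.

Lemma twisted_le_wlen w phi : twisted w phi <= wlen w / m.
Proof.
by rewrite (le_trans (twisted_le_size _ _))// ler_pdivlMr// size_le_wlen.
Qed.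

Lemma twisted_sum_cos w phi theta :
  twisted w phi + twisted w (phi + theta *+ 2) =
  2 * cos theta * twisted w (phi + theta).
Proof.
elim: w phi => [|b w IH] phi /=; first by rewrite addr0 mulr0.
rewrite addrACA.
rewrite (_ : phi + theta *+ 2 + 2 * pi * omega * p 0 b =
  phi + 2 * pi * omega * p 0 b + theta *+ 2); last by rewrite addrAC.
rewrite IH.
rewrite (_ : phi + theta + 2 * pi * omega * p 0 b =
  phi + 2 * pi * omega * p 0 b + theta); last by rewrite addrAC.
rewrite (mulrDr (2 * cos theta)); congr (_ + _).
rewrite -(mulrDr (b == a)%:R) mulrCA; congr (_ * _).
rewrite (_ : phi + theta *+ 2 = (phi + theta) + theta); last by rewrite mulr2n addrA.
rewrite -[in cos phi](addrK theta phi); set psi := phi + theta.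
by rewrite cosB cosD; ring.
Qed.

Lemma twistedDpi w phi : twisted w (phi + pi) = - twisted w phi.
Proof.
elim: w phi => [|b w IH] phi /=; first by rewrite oppr0.
by rewrite addrAC IH cosDpi mulrN opprD.
Qed.

Lemma twisted_pair_le w phi theta B : (forall psi, twisted w psi <= B) ->
  twisted w phi + twisted w (phi + theta *+ 2) <= (2 - sin theta ^+ 2) * B.
Proof.
move=> wB; rewrite twisted_sum_cos.
(* Adding pi to the phase changes the sign, so a bound for all phases is a bound in absolute
   value. *)
have wN psi : `|twisted w psi| <= B.
  by rewrite ler_norml lerNl -twistedDpi !wB.
have B0 : 0 <= B by exact: le_trans (wN 0).
rewrite (le_trans (ler_norm _))// normrM ler_pM//.
by rewrite normrM normr_nat norm_cos_le.
Qed.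

Lemma twisted_iter_le n V :
  (forall b phi, twisted (subst n [:: b]) phi <= V * p 0 b) ->
  forall w phi, twisted (subst n w) phi <= V * wlen w.
Proof.
move=> H; elim=> [|b w IH] phi.
  by rewrite iter_subst_flatten /wlen big_nil mulr0.
by rewrite iter_subst_cons twisted_cat wlen_cons (mulrDr V) lerD.
Qed.

Lemma twisted_iterS_le n V :
  (forall b phi, twisted (subst n [:: b]) phi <= V * p 0 b) ->
  forall b phi, twisted (subst n.+1 [:: b]) phi <= V * alpha * p 0 b.
Proof.
move=> H b phi; rewrite iterSr (le_trans (twisted_iter_le H _ _))//.
by rewrite wlen_subst_word wlen1 mulrA.
Qed.

Section ReturnWord.
Variables (c : 'I_d) (v : seq 'I_d) (k : nat).
Hypothesis k_gt0 : (0 < k)%N.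
Hypothesis cvc : forall b, exists u w, subst k [:: b] = u ++ c :: v ++ c :: w.

Let s n := sin (pi * (omega * wlen (c :: v) * alpha ^+ n)) ^+ 2.

(** In the image under zeta^n of u c v c w, the phases of the two copies of zeta^n(c) differ by 2 pi
    omega |c v|_p alpha^n. By [twisted_pair_le] this pair saves V p_c s_n; the other blocks get the
    bound of the hypothesis. *)
Lemma twisted_savings n V :
  (forall b phi, twisted (subst n [:: b]) phi <= V * p 0 b) ->
  forall b phi, twisted (subst (n + k) [:: b]) phi <=
    V * (alpha ^+ k * p 0 b - p 0 c * s n).
Proof.
move=> H b phi; rewrite iterD.
have Hw := twisted_iter_le H.
have [u [w uw]] := cvc b.
have lenE : alpha ^+ k * p 0 b = wlen u + p 0 c *+ 2 + wlen v + wlen w.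
  rewrite -wlen1 -wlen_iter_subst uw wlen_cat wlen_cons wlen_cat wlen_cons.
  by rewrite mulr2n; ring.
rewrite uw iter_subst_cat twisted_cat (iter_subst_cons zeta n c (v ++ _)) twisted_cat.
rewrite iter_subst_cat twisted_cat (iter_subst_cons zeta n c w) twisted_cat.
set phi1 := phi + _.
set phi2 := phi1 + _.
set phi3 := phi2 + _.
have phi3E : phi3 = phi1 + (pi * (omega * wlen (c :: v) * alpha ^+ n)) *+ 2.
  by rewrite /phi3 /phi2 !wlen_iter_subst wlen1 wlen_cons mulr2n; ring.
have pair : twisted (subst n [:: c]) phi1 + twisted (subst n [:: c]) phi3 <=
    (2 - s n) * (V * p 0 c).
  by rewrite phi3E; apply: twisted_pair_le => psi; exact: H.
have /= hu := Hw u phi.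
have /= hv := Hw v phi2.
have /= hw := Hw w (phi3 + 2 * pi * omega * wlen (subst n [:: c])).
rewrite lenE mulr2n.
apply: (@le_trans _ _ (V * wlen u + ((2 - s n) * (V * p 0 c)) + V * wlen v + V * wlen w)).
  by move: hu hv hw pair; lra.
by rewrite le_eqVlt; apply/orP; left; apply/eqP; ring.
Qed.

(** The denominator bounds alpha^k p_b for every b, so the saving p_c s_n is at least the proportion
    c0 s_n of alpha^k p_b. *)
Let c0 := p 0 c / (alpha ^+ k * M).

(* The exponent gained after n steps: every m < n in the residue class of n
   modulo k contributes c0 * s m. *)
Let gain n := c0 * \sum_(j < n %/ k) s (n %% k + j * k).

Let gainD n : gain (n + k) = gain n + c0 * s n.
Proof.
rewrite /gain divnDr ?dvdnn// divnn k_gt0 modnDr addn1 big_ord_recr/=.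
by rewrite mulrDr addnC -divn_eq.
Qed.

(** From N to N + 1 the window of k indices loses [gain N] and receives [gain (N + k)], larger by c0
    s_N. *)
Let gain_sum N : \sum_(i < k) gain (N + i) = c0 * \sum_(n < N) s n.
Proof.
elim: N => [|N IH].
  rewrite big_ord0 mulr0 big1// => i _.
  by rewrite add0n /gain divn_small// big_ord0 mulr0.
rewrite big_ord_recr/= mulrDr -IH.
move: gainD; case: (k) k_gt0 => // k' _ gD.
rewrite big_ord_recr big_ord_recl/= addn0 addSnnS gD.
rewrite addrC -!addrA; congr (_ + _); rewrite addrC; congr (_ + _).
by apply: eq_bigr => i _; rewrite addSnnS.
Qed.

(** Strong induction by steps of k, each saving becoming an exponential through 1 - u <= exp(- u).
    For n < k the gain is 0 and counting letters suffices. *)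
Lemma twisted_gain n b phi :
  twisted (subst n [:: b]) phi <= m^-1 * alpha ^+ n * expR (- gain n) * p 0 b.
Proof.
have a0 : 0 < alpha by exact: lt_trans alpha_gt1.
elim/ltn_ind: n b phi => n IH b phi.
have [nk|kn] := ltnP n k.
  rewrite /gain divn_small// big_ord0 mulr0 oppr0 expR0 mulr1.
  by rewrite (le_trans (twisted_le_wlen _ _))// wlen_iter_subst wlen1 mulrC mulrA.
have {kn}nE : n = (n - k + k)%N by rewrite subnK.
have nk : (n - k < n)%N by rewrite nE addnK -[X in (X < _)%N]addn0 ltn_add2l.
move: (n - k)%N nE nk IH => n' -> n'n IH.
have M0 : 0 < M by rewrite (lt_le_trans _ (M_ge c)).
set V := m^-1 * alpha ^+ n' * expR (- gain n').
have V0 : 0 <= V by rewrite !mulr_ge0 ?invr_ge0 ?exprn_ge0 ?expR_ge0// ltW.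
have := @twisted_savings n' V (IH n' n'n) b phi.
move=> /le_trans; apply.
rewrite gainD opprD expRD exprD.
rewrite [leRHS](_ : _ = V * (alpha ^+ k * expR (- (c0 * s n')) * p 0 b)); last by rewrite /V; ring.
rewrite ler_wpM2l//.
have s0 : 0 <= s n' by rewrite sqr_ge0.
have ak : 0 < alpha ^+ k by rewrite exprn_gt0.
apply: (@le_trans _ _ (alpha ^+ k * (1 - c0 * s n') * p 0 b)); last first.
  by apply: ler_wpM2r; [exact: ltW|rewrite ler_pM2l// expR_ge1Dx].
have : c0 * p 0 b * alpha ^+ k <= p 0 c.
  rewrite /c0 (_ : _ * _ = p 0 c * (p 0 b / M)); last by field; rewrite !gt_eqF.
  by apply: ler_piMr; [exact: ltW|rewrite ler_pdivrMr// mul1r].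
move=> /(ler_wpM2r s0); lra.
Qed.

(** One of the gains at N, ..., N + k - 1 is at least their average. Each remaining substitution up
    to N + k multiplies the bound by alpha, which loses nothing relative to the length. *)
Lemma twisted_iter_bound N b phi :
  twisted (subst (N + k) [:: b]) phi <= m^-1 * alpha ^+ (N + k) *
    expR (- (c0 / k%:R * \sum_(n < N) s n)) * p 0 b.
Proof.
have a0 : 0 < alpha by exact: lt_trans alpha_gt1.
have [i hi] : exists i : 'I_k, c0 / k%:R * \sum_(n < N) s n <= gain (N + i).
  apply/existsP; apply: contraT; rewrite negb_exists => /forallP nall.
  suff : \sum_(i < k) gain (N + i) < \sum_(i < k) (c0 / k%:R * \sum_(n < N) s n).
    rewrite gain_sum sumr_const card_ord (_ : _ *+ k = c0 * \sum_(n < N) s n) ?ltxx//.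
    by rewrite -[LHS]mulr_natr; field; rewrite pnatr_eq0 -lt0n.
  apply: ltr_sum => [|i _]; last by rewrite ltNge nall.
  by apply/hasP; exists (Ordinal k_gt0); rewrite ?mem_index_enum.
have step j b' psi : twisted (subst (N + i + j) [:: b']) psi <=
    m^-1 * alpha ^+ (N + i) * expR (- gain (N + i)) * alpha ^+ j * p 0 b'.
  elim: j b' psi => [|j IH] b' psi.
    by rewrite addn0 expr0 mulr1; exact: twisted_gain.
  by rewrite addnS exprSr mulrA; exact: twisted_iterS_le.
have NkE : (N + k = N + i + (k - i))%N by rewrite -addnA subnKC// ltnW.
rewrite [X in subst X _]NkE (le_trans (step _ _ _))// NkE (exprD _ (N + i)).
apply: ler_wpM2r; first exact: ltW.
rewrite mulrAC (mulrA m^-1).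
apply: ler_wpM2l; last by rewrite ler_expR lerN2.
by rewrite !mulr_ge0 ?invr_ge0 ?exprn_ge0// ltW.
Qed.

End ReturnWord.

(** Complete blocks zeta^n(b) cost V times their length; the last, possibly incomplete, block has at
    most alpha^n M / m letters. *)
Lemma twisted_prefix_le n V : 0 <= V ->
  (forall b phi, twisted (subst n [:: b]) phi <= V * wlen (subst n [:: b])) ->
  forall u w t phi, subst n u = w ++ t ->
    twisted w phi <= V * wlen w + alpha ^+ n * M / m.
Proof.
move=> V0 H; have a0 : 0 < alpha by exact: lt_trans alpha_gt1.
have short b t w' phi : subst n [:: b] = t ++ w' ->
    twisted t phi <= V * wlen t + alpha ^+ n * M / m.
  move=> E; rewrite (le_trans (twisted_le_wlen _ _))//.
  rewrite -[leLHS]add0r lerD ?mulr_ge0 ?wlen_ge0//.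
  apply: ler_wpM2r; first by rewrite invr_ge0 ltW.
  apply: (@le_trans _ _ (alpha ^+ n * p 0 b)).
    by rewrite -wlen1 -wlen_iter_subst E wlen_cat lerDl wlen_ge0.
  by apply: ler_wpM2l => //; rewrite exprn_ge0// ltW.
elim=> [|b u IH] w t phi.
  rewrite iter_subst_flatten/=; case: w => // _.
  rewrite /= addr_ge0 ?mulr_ge0 ?wlen_ge0 ?exprn_ge0 ?invr_ge0//; try exact: ltW.
  exact: le_trans (ltW (p_gt0 a)) (M_ge a).
rewrite iter_subst_cons => E.
have [le|gt] := leqP (size w) (size (subst n [:: b])).
  have wE : w = take (size w) (subst n [:: b]).
    by rewrite -(takel_cat (subst n u) le) E take_size_cat.
  apply: (@short b _ (drop (size w) (subst n [:: b]))).
  by rewrite {1}wE cat_take_drop.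
have wE : w = subst n [:: b] ++ drop (size (subst n [:: b])) w.
  rewrite -{1}(cat_take_drop (size (subst n [:: b])) w); congr (_ ++ _).
  by rewrite -(takel_cat t (ltnW gt)) -E take_size_cat.
set w' := drop _ _ in wE.
have E' : subst n u = w' ++ t.
  by move: E; rewrite wE -catA => /eqP; rewrite eqseq_cat// eqxx => /eqP.
by rewrite wE twisted_cat wlen_cat (mulrDr V) -addrA lerD ?(IH _ _ _ E').
Qed.

(** There may be an incomplete block at each end, whence the factor 2; after the first one,
    [twisted_prefix_le] applies. *)
Lemma twisted_infix_le n V : 0 <= V ->
  (forall b phi, twisted (subst n [:: b]) phi <= V * wlen (subst n [:: b])) ->
  forall u w phi, infix w (subst n u) ->
    twisted w phi <= V * wlen w + 2 * (alpha ^+ n * M / m).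
Proof.
move=> V0 H; have a0 : 0 < alpha by exact: lt_trans alpha_gt1.
have M0 : 0 < M by rewrite (lt_le_trans _ (M_ge a)).
have C0 : 0 <= alpha ^+ n * M / m.
  by rewrite !mulr_ge0 ?exprn_ge0 ?invr_ge0// ltW.
move=> u w phi /infixP[x [y]].
elim: u x => [|b u IH] x.
  rewrite iter_subst_flatten/= => /(congr1 size)/esym/eqP.
  rewrite !size_cat !addn_eq0 => /and3P[_ /nilP -> _] /=.
  by rewrite addr_ge0// ?(mulr_ge0 V0) ?wlen_ge0// mulr_ge0.
rewrite iter_subst_cons => E.
have [le|gt] := leqP (size (subst n [:: b])) (size x).
  apply: (IH (drop (size (subst n [:: b])) x)).
  move: (congr1 (drop (size (subst n [:: b]))) E).
  rewrite (drop_size_cat (subst n u) erefl) drop_cat; move: le; rewrite leq_eqVlt => /predU1P[eq|->//].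
  by rewrite eq ltnn subnn drop0 drop_size.
have [t tE] : exists t, subst n [:: b] = x ++ t.
  exists (drop (size x) (subst n [:: b])).
  rewrite -[LHS](cat_take_drop (size x)); congr (_ ++ _).
  by rewrite -(takel_cat (subst n u) (ltnW gt)) E take_size_cat.
have {}E : t ++ subst n u = w ++ y.
  by move: E; rewrite tE -catA => /eqP; rewrite eqseq_cat// eqxx => /eqP.
have short z psi : wlen z <= wlen t ->
    twisted z psi <= V * wlen z + alpha ^+ n * M / m.
  move=> zt; rewrite (le_trans (twisted_le_wlen _ _))//.
  rewrite -[leLHS]add0r lerD ?mulr_ge0 ?wlen_ge0//.
  apply: ler_wpM2r; first by rewrite invr_ge0 ltW.
  apply: (le_trans zt).
  apply: (@le_trans _ _ (alpha ^+ n * p 0 b)).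
    by rewrite -wlen1 -wlen_iter_subst tE wlen_cat lerDr wlen_ge0.
  by apply: ler_wpM2l => //; rewrite exprn_ge0// ltW.
have [le|gt'] := leqP (size w) (size t).
  have wE : t = w ++ drop (size w) t.
    rewrite -{1}(cat_take_drop (size w) t); congr (_ ++ _).
    by rewrite -(takel_cat (subst n u) le) E take_size_cat.
  have : wlen w <= wlen t by rewrite [in leRHS]wE wlen_cat lerDl wlen_ge0.
  by move=> /(short w phi); move: C0; lra.
have wE : w = t ++ drop (size t) w.
  rewrite -{1}(cat_take_drop (size t) w); congr (_ ++ _).
  by rewrite -(takel_cat y (ltnW gt')) -E take_size_cat.
set w' := drop _ _ in wE.
have E' : subst n u = w' ++ y.
  by move: E; rewrite wE -catA => /eqP; rewrite eqseq_cat// eqxx => /eqP.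
rewrite wE twisted_cat wlen_cat (mulrDr V).
have h1 := short t phi (lexx _).
have h2 := twisted_prefix_le V0 H (phi + 2 * pi * omega * wlen t) E'.
lra.
Qed.

(** For n <= K, the word zeta^K(b) is an image under zeta^n; for K < n the length is at most alpha^n
    M and the trivial bound is enough. *)
Lemma twisted_language_le n V : 0 <= V ->
  (forall b phi, twisted (subst n [:: b]) phi <= V * wlen (subst n [:: b])) ->
  forall K b w phi, infix w (subst K [:: b]) ->
    twisted w phi <= V * wlen w + 2 * (alpha ^+ n * M / m).
Proof.
move=> V0 H K b w phi.
have [nK|Kn] := leqP n K.
  by rewrite -(subnKC nK) iterD; exact: twisted_infix_le.
move=> /infixP[x [y E]].
have a0 : 0 < alpha by exact: lt_trans alpha_gt1.
have M0 : 0 < M by rewrite (lt_le_trans _ (M_ge a)).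
rewrite (le_trans (twisted_le_wlen _ _))//.
have : wlen w / m <= alpha ^+ n * M / m.
  apply: ler_wpM2r; first by rewrite invr_ge0 ltW.
  apply: (@le_trans _ _ (alpha ^+ K * p 0 b)).
    by rewrite -wlen1 -wlen_iter_subst E !wlen_cat addrCA lerDl addr_ge0 ?wlen_ge0.
  apply: ler_pM => //; [by rewrite exprn_ge0// ltW|exact: ltW|].
  by rewrite ler_weXn2l ?ltW// ltnW.
have : 0 <= V * wlen w by rewrite mulr_ge0 ?wlen_ge0.
have : 0 <= alpha ^+ n * M / m.
  by rewrite !mulr_ge0 ?exprn_ge0 ?invr_ge0// ltW.
lra.
Qed.

End Fixed.
End TwistedSums.

(** * Powers of complex numbers *)

Section ComplexModulus.
Context {R : realType}.
Implicit Types z w : R[i].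
Local Open Scope complex_scope.

(** The norm of [R[i]] takes its values in [R[i]]; this is the modulus as a real number. *)
Definition cabs z : R := complex.Re `|z|.

Lemma cabsE z : (cabs z)%:C = `|z|.
Proof. by rewrite RRe_real ?normr_real. Qed.

Lemma cabs_ge0 z : 0 <= cabs z.
Proof. by rewrite -lecR cabsE rmorph0 normr_ge0. Qed.

Lemma cabsM z w : cabs (z * w) = cabs z * cabs w.
Proof. by apply: complexI; rewrite rmorphM/= !cabsE normrM. Qed.

Lemma cabsX z n : cabs (z ^+ n) = cabs z ^+ n.
Proof. by apply: complexI; rewrite rmorphXn/= !cabsE normrX. Qed.

Lemma cabsD z w : cabs (z + w) <= cabs z + cabs w.
Proof. by rewrite -lecR rmorphD/= !cabsE ler_normD. Qed.

Lemma cabsN z : cabs (- z) = cabs z.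
Proof. by apply: complexI; rewrite !cabsE normrN. Qed.

Lemma cabsB z w : cabs (z - w) <= cabs z + cabs w.
Proof. by rewrite -(cabsN w) cabsD. Qed.

Lemma cabs0 : cabs 0 = 0.
Proof. by apply: complexI; rewrite cabsE normr0. Qed.

Lemma cabs1 : cabs 1 = 1.
Proof. by apply: complexI; rewrite cabsE normr1. Qed.

Lemma cabs_eq0 z : (cabs z == 0) = (z == 0).
Proof. by rewrite -(inj_eq (@complexI R)) cabsE normr_eq0. Qed.

Lemma cabs_real (x : R) : cabs x%:C = `|x|.
Proof. by rewrite /cabs normc_def /= expr0n /= addr0 sqrtr_sqr. Qed.

Lemma cabs_sum (I : Type) (s : seq I) (P : pred I) (F : I -> R[i]) :
  cabs (\sum_(i <- s | P i) F i) <= \sum_(i <- s | P i) cabs (F i).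
Proof.
elim/big_ind2: _ => [|a z b w az bw|//]; first by rewrite cabs0.
by rewrite (le_trans (cabsD _ _))// lerD.
Qed.

Lemma cabs_sqr z : cabs z ^+ 2 = complex.Re z ^+ 2 + complex.Im z ^+ 2.
Proof. by apply: complexI; rewrite rmorphXn/= cabsE add_Re2_Im2. Qed.

Lemma cabs_le_ReIm z : cabs z <= `|complex.Re z| + `|complex.Im z|.
Proof.
rewrite -(@ler_sqr R) ?nnegrE ?cabs_ge0 ?addr_ge0// cabs_sqr sqrrD.
by rewrite !real_normK ?num_real// lerD2r lerDl mulrn_wge0.
Qed.

Lemma Re_le_cabs z : complex.Re z <= cabs z.
Proof.
rewrite (le_trans (ler_norm _))// -(@ler_sqr R) ?nnegrE ?cabs_ge0//.
by rewrite real_normK ?num_real// cabs_sqr lerDl sqr_ge0.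
Qed.

Lemma cabs_exprB1 z k : cabs z = 1 -> cabs (z ^+ k - 1) <= k%:R * cabs (z - 1).
Proof.
move=> z1; rewrite subrX1 cabsM mulrC ler_wpM2r ?cabs_ge0//.
rewrite (le_trans (cabs_sum _ _ _))//.
under eq_bigr do rewrite cabsX z1 expr1n.
by rewrite sumr_const card_ord.
Qed.

(* The geometric sums of the powers of z are bounded, so these powers cannot
   all stay in the half-plane of real part at least 1/2. *)
Lemma exists_expr_far z : cabs z = 1 -> z != 1 ->
  exists k, 1 <= cabs (z ^+ k - 1).
Proof.
move=> z1 zn1; apply: contrapT => /forallNP near.
have Rez k : 2^-1 <= complex.Re (z ^+ k).
  have /negP := near k; rewrite -ltNge => zk.
  have c1 : cabs (z ^+ k) ^+ 2 = 1 by rewrite cabsX z1 expr1n expr1n.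
  have : cabs (z ^+ k - 1) ^+ 2 <= 1.
    by rewrite expr_le1// ?cabs_ge0// ltW.
  move: c1; rewrite !cabs_sqr raddfB/= raddfB/= subr0.
  by rewrite !expr2; nra.
have z10 : 0 < cabs (z - 1).
  by rewrite lt_neqAle eq_sym cabs_eq0 subr_eq0 zn1 cabs_ge0.
pose N := (Num.trunc (2 / cabs (z - 1))).+1.
have Nlt : 2 < cabs (z - 1) * N%:R.
  by rewrite mulrC -ltr_pdivrMr// truncnS_gt.
have /negP := near N; rewrite -ltNge subrX1 cabsM.
apply/negP; rewrite -leNgt.
have : N%:R / 2 <= cabs (\sum_(i < N) z ^+ i).
  rewrite (le_trans _ (Re_le_cabs _))// raddf_sum/=.
  rewrite (_ : N%:R / 2 = \sum_(i < N) 2^-1); last first.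
    by rewrite sumr_const card_ord -[RHS]mulr_natl.
  by apply: ler_sum => i _.
move: (cabs (\sum_(i < N) z ^+ i)) => s hs.
have h := ler_wpM2l (ltW z10) hs.
by move: Nlt h; set u := cabs _; set v := N%:R; nra.
Qed.

(** Pigeonhole: among K + 1 powers of z two lie in the same of K square cells, and their quotient is
    close to 1. That K is uniform in z matters in [dirichlet]. *)
Lemma dirichlet1 (e : R) : 0 < e -> exists2 K, (0 < K)%N &
  forall z, cabs z = 1 -> exists j, (0 < j <= K)%N /\ cabs (z ^+ j - 1) < e.
Proof.
move=> e0; pose q := (Num.trunc (2 / e)).+1.
have qe : 2 < e * q%:R by rewrite mulrC -ltr_pdivrMr// truncnS_gt.
have q0 : 0 < q%:R :> R by rewrite ltr0n.
pose K := #|{: 'I_(2 * q).+1 * 'I_(2 * q).+1}|.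
exists K; first by rewrite /K card_prod !card_ord.
move=> z z1.
(* The endpoint x = 1 has value 2 q, hence 2 q + 1 cells in each direction. *)
pose cell (x : R) : 'I_(2 * q).+1 := inord (Num.trunc ((x + 1) * q%:R)).
have cellP (x y : R) : `|x| <= 1 -> `|y| <= 1 -> cell x = cell y ->
    `|x - y| < q%:R^-1.
  move=> x1 y1 /(congr1 val).
  have bd (u : R) : `|u| <= 1 ->
      (Num.trunc ((u + 1) * q%:R) < (2 * q).+1)%N /\ 0 <= (u + 1) * q%:R.
    rewrite ler_norml => /andP[u1 u2]; have u0 : 0 <= (u + 1) * q%:R.
      by rewrite mulr_ge0//; lra.
    split=> //; rewrite ltnS -(@ler_nat R).
    apply: (@le_trans _ _ ((u + 1) * q%:R)); first by rewrite truncn_le.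
    by rewrite natrM ler_wpM2r//; lra.
  have [bx x0] := bd x x1; have [by' y0] := bd y y1.
  rewrite /= !inordK// => E.
  move: (truncnS_gt ((x + 1) * q%:R)) (truncnS_gt ((y + 1) * q%:R)) x0 y0.
  rewrite -!truncn_le E.
  set T := Num.trunc _; rewrite -(natr1 T) => h3 h4 h1 h2.
  rewrite -(@ltr_pM2r _ q%:R)// mulVf ?gt_eqF//.
  rewrite -[X in _ * X](ger0_norm (ltW q0)) -normrM ltr_norml.
  by move: h1 h2 h3 h4; rewrite !mulrDl !mul1r; lra.
have ReIm (w : R[i]) : cabs w = 1 -> `|complex.Re w| <= 1 /\ `|complex.Im w| <= 1.
  move=> w1; have := cabs_sqr w; rewrite w1 expr1n => E.
  have sq u : u ^+ 2 <= 1 -> `|u| <= 1 :> R.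
    by rewrite -(@expr_le1 _ 2 `|u|)// real_normK ?num_real.
  by split; apply: sq; rewrite E ?lerDl ?lerDr sqr_ge0.
pose f (i : 'I_K.+1) := (cell (complex.Re (z ^+ i)), cell (complex.Im (z ^+ i))).
have /injectivePn[i [j ij fij]] : ~~ injectiveb f.
  apply/negP => /injectiveP/leq_card; rewrite card_ord.
  by rewrite -/K ltnn.
wlog ltij : i j ij fij / (i < j)%N.
  move=> H; case: (ltngtP i j) => [|ji|/val_inj eij]; first exact: H.
    by apply: (H j i) => //; rewrite eq_sym.
  by rewrite eij eqxx in ij.
exists (j - i)%N; split.
  by rewrite subn_gt0 ltij/= leq_subLR (leq_trans (leq_ord j))// leq_addl.
have zi k : cabs (z ^+ k) = 1 by rewrite cabsX z1 expr1n.
rewrite -[ltLHS]mul1r -(zi i) -cabsM mulrBr mulr1 -exprD subnKC ?(ltnW ltij)//.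
have [ri ii] := ReIm _ (zi i); have [rj ij'] := ReIm _ (zi j).
move: fij => [] /(cellP _ _ ri rj) h1 /(cellP _ _ ii ij') h2.
rewrite (le_lt_trans (cabs_le_ReIm _))// !raddfB/=.
rewrite distrC [X in _ + X]distrC.
have : q%:R^-1 + q%:R^-1 < e.
  have : 2 / q%:R < e by rewrite ltr_pdivrMr.
  by lra.
by move: h1 h2; lra.
Qed.

(** Induction: a time k for the tail, precise to e / K, is multiplied by some j <= K that brings u^k
    close to 1; by [cabs_exprB1] the tail loses at most a factor K. *)
Lemma dirichlet (us : seq R[i]) (e : R) : 0 < e ->
  (forall z, z \in us -> cabs z = 1) ->
  exists2 k, (0 < k)%N & forall z, z \in us -> cabs (z ^+ k - 1) < e.
Proof.
elim: us e => [|u us IH] e e0 us1; first by exists 1%N.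
have [K K0 HK] := dirichlet1 e0.
have K0' : 0 < K%:R :> R by rewrite ltr0n.
have [k k0 Hk] : exists2 k, (0 < k)%N & forall z, z \in us -> cabs (z ^+ k - 1) < e / K%:R.
  by apply: IH => [|z zu]; [rewrite divr_gt0|rewrite us1// in_cons zu orbT].
have [|j [/andP[j0 jK] Hj]] := HK (u ^+ k).
  by rewrite cabsX us1 ?mem_head// expr1n.
exists (k * j)%N => [|z]; first by rewrite muln_gt0 k0.
rewrite in_cons => /predU1P[->|zu]; first by rewrite exprM.
rewrite exprM (le_lt_trans (cabs_exprB1 _ _))//.
  by rewrite cabsX us1 ?in_cons ?zu ?orbT// expr1n.
have jk : j%:R * cabs (z ^+ k - 1) <= K%:R * cabs (z ^+ k - 1).
  by rewrite ler_wpM2r ?cabs_ge0// ler_nat.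
rewrite (le_lt_trans jk)// mulrC -ltr_pdivlMr//; exact: Hk.
Qed.

(* Lagrange interpolation recovers each coefficient e z of the exponential sum
   from its values at the times i < size zs. *)
Lemma vandermonde_bound (zs : seq R[i]) : uniq zs -> exists2 C : R, 0 < C &
  forall (e : R[i] -> R[i]) (B : R),
    (forall i, (i < size zs)%N -> cabs (\sum_(z <- zs) e z * z ^+ i) <= B) ->
    forall z, z \in zs -> cabs (e z) <= C * B.
Proof.
move=> uzs; set n := size zs.
pose q z : {poly R[i]} :=
  \prod_(w <- rem z zs) ((z - w)^-1 *: ('X - w%:P)).
have qP z w : z \in zs -> w \in zs -> (q z).[w] = (w == z)%:R.
  move=> zz wz; rewrite /q horner_prod; case: eqVneq => [->|wnz].
    rewrite big_seq big1// => u; rewrite mem_rem_uniq// => /andP[/= uz _].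
    by rewrite !hornerE mulVf// subr_eq0 eq_sym.
  rewrite (big_rem w) ?mem_rem_uniq ?inE ?wnz//=.
  by rewrite !hornerE subrr mulr0 mul0r.
have sq z : z \in zs -> (size (q z) <= n)%N.
  move=> zz; rewrite /n (perm_size (perm_to_rem zz))/= /q.
  elim: (rem z zs) => [|w s IH]; first by rewrite big_nil size_poly1.
  rewrite big_cons (leq_trans (size_polyMleq _ _))//.
  have : (size ((z - w)^-1 *: ('X - w%:P)) <= 2)%N.
    by rewrite (leq_trans (size_scale_leq _ _))// size_XsubC.
  by move=> /leq_add/(_ IH) h; rewrite -subn1 leq_subLR.
pose C z := \sum_(i < n) cabs (q z)`_i.
exists (1 + \sum_(z <- zs) C z).
  rewrite ltr_pwDl// sumr_ge0// => z _; apply: sumr_ge0 => i _; exact: cabs_ge0.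
move=> e B hB z zz.
have C0 w : 0 <= C w by apply: sumr_ge0 => i _; exact: cabs_ge0.
have B0 : 0 <= B.
  have n0 : (0 < n)%N by rewrite /n; case: (zs) zz.
  exact: le_trans (cabs_ge0 _) (hB 0%N n0).
have -> : e z = \sum_(i < n) (q z)`_i * (\sum_(w <- zs) e w * w ^+ i).
  under eq_bigr do rewrite mulr_sumr.
  rewrite exchange_big/=.
  transitivity (\sum_(w <- zs) e w * (q z).[w]).
    rewrite (big_rem z)//= qP// eqxx mulr1 big_seq big1 ?addr0// => w.
    by rewrite mem_rem_uniq// inE => /andP[wz ws]; rewrite qP// (negbTE wz) mulr0.
  apply: eq_bigr => w _; rewrite (horner_coef_wide _ (sq z zz)) mulr_sumr.
  by apply: eq_bigr => i _; rewrite mulrCA.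
rewrite (le_trans (cabs_sum _ _ _))//.
apply: (@le_trans _ _ (C z * B)).
  rewrite /C mulr_suml; apply: ler_sum => i _.
  by rewrite cabsM ler_wpM2l ?cabs_ge0// hB.
rewrite ler_wpM2r// (big_rem z)//= -[leLHS]add0r lerD//.
by rewrite lerDl sumr_ge0.
Qed.

End ComplexModulus.

(** * Density of the times of non-return *)

Section Density.
Context {R : realType}.

(** Disjoint windows of length W each contribute at least b to the sum of s_n + s_(n+g), in which
    every s_n counts at most twice. *)
Lemma sum_lower_density (s : nat -> R) (b : R) (W g n0 : nat) :
  (forall n, 0 <= s n) -> 0 < b -> (0 < W)%N ->
  (forall n, (n0 <= n)%N -> exists i, (i < W)%N /\ b <= s (n + i)%N + s (n + i + g)%N) ->
  exists N0, forall N, (N0 <= N)%N ->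
    b / (4 * W%:R) * N%:R <= \sum_(n < N) s n.
Proof.
move=> s0 b0 W0 sW.
have mono (f : nat -> R) a c : (forall n, 0 <= f n) -> (a <= c)%N ->
    \sum_(n < a) f n <= \sum_(n < c) f n.
  move=> f0 /subnKC <-; rewrite big_split_ord/= lerDl.
  by apply: sumr_ge0.
have pair_sum q : q%:R * b <= \sum_(n < n0 + q * W) (s n + s (n + g)%N).
  elim: q => [|q IH].
    by rewrite mul0r; apply: sumr_ge0 => i _; rewrite addr_ge0.
  rewrite mulSn (addnC W) addnA big_split_ord/= -natr1 mulrDl mul1r lerD//.
  have [i [iW hi]] := sW (n0 + q * W)%N (leq_addr _ _).
  rewrite (bigD1 (Ordinal iW))//= (le_trans hi)// lerDl.
  by apply: sumr_ge0 => j _; rewrite addr_ge0.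
have shift N : \sum_(n < N) s (n + g)%N <= \sum_(n < N + g) s n.
  rewrite addnC big_split_ord/= -[leLHS]add0r lerD ?sumr_ge0//.
  by apply: ler_sum => i _; rewrite addnC.
(* From this N on, the q windows cover at least half of the N times. *)
exists (2 * (n0 + g + W))%N => N NN.
pose q := ((N - n0 - g) %/ W)%N.
have qN : (n0 + q * W + g <= N)%N by have := leq_trunc_div (N - n0 - g) W; lia.
have hq : q%:R * b <= 2 * \sum_(n < N) s n.
  rewrite (le_trans (pair_sum q))// big_split/= mulr_natl mulr2n lerD//.
    by apply: mono => //; lia.
  by rewrite (le_trans (shift _))//; exact: mono.
have Nq : (N <= 2 * (q * W))%N.
  by have := ltn_ceil (N - n0 - g) W0; rewrite -/q mulSn; lia.
have {Nq} Nq : N%:R <= 2 * (q%:R * W%:R) :> R by rewrite -!natrM ler_nat.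
have W0' : 0 < W%:R :> R by rewrite ltr0n.
have : b / (4 * W%:R) * N%:R <= b / (4 * W%:R) * (2 * (q%:R * W%:R)).
  by rewrite ler_wpM2l// divr_ge0 ?mulr_ge0 ?ltW.
rewrite (_ : b / (4 * W%:R) * (2 * (q%:R * W%:R)) = q%:R * b / 2); last first.
  by field; rewrite gt_eqF.
by move=> /le_trans; apply; lra.
Qed.

(** Only finitely many L <= A and nonzero residues modulo L occur, and each gives a positive
    value. *)
Lemma sin2_rational_gap (A : R) : exists2 m : R, 0 < m <= 1 &
  forall (L : nat) (t : int), (0 < L)%N -> L%:R <= A -> ~~ (L%:Z %| t)%Z ->
    m <= sin (pi * (t%:~R / L%:R)) ^+ 2.
Proof.
pose K := (Num.trunc A).+1.
pose f (L r : nat) : R := sin (pi * (r%:R / L%:R)) ^+ 2.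
exists (\big[Num.min/1]_(L < K) \big[Num.min/1]_(r < L | (0 < r)%N) f L r).
  rewrite bigmin_le_id andbT; apply: lt_bigmin => // L _.
  apply: lt_bigmin => // r r0; have L0 : (0 < L)%N by exact: leq_ltn_trans (ltn_ord r).
  rewrite exprn_gt0// sin_gt0_pi// mulr_gt0 ?pi_gt0 ?divr_gt0 ?ltr0n//=.
  by rewrite gtr_pMr ?pi_gt0// ltr_pdivrMr ?ltr0n// mul1r ltr_nat.
move=> L t L0 LA Lt.
have L0' : 0 < L%:R :> R by rewrite ltr0n.
have LK : (L < K)%N by rewrite -(@ltr_nat R) (le_lt_trans LA)// truncnS_gt.
have [r [rE r0 rL]] : exists r : nat, [/\ (t %% L)%Z = r, (0 < r)%N & (r < L)%N].
  exists `|(t %% L)%Z|%N.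
  have Ln0 : (L%:Z != 0) by rewrite eqz_nat -lt0n.
  have := modz_ge0 t Ln0; have := ltz_pmod t (_ : 0 < L%:Z).
  rewrite ltz_nat L0 => /(_ isT) h1 h2; split; first by rewrite gez0_abs.
    by rewrite absz_gt0; apply: contra Lt => /eqP/dvdz_mod0P.
  by rewrite -ltz_nat gez0_abs.
have -> : sin (pi * (t%:~R / L%:R)) ^+ 2 = f L r.
  rewrite /f -[RHS](sin2_piDint _ (t %/ L)%Z); congr (sin (pi * _) ^+ 2).
  by rewrite {1}(divz_eq t L) rE rmorphD rmorphM/= mulrDl mulfK ?gt_eqF// addrC.
apply: (@le_trans _ R (\big[Num.min/1]_(r < L | (0 < r)%N) f L r)).
  exact: (bigmin_le_cond 1 (fun L : 'I_K => \big[Num.min/1]_(r < L | (0 < r)%N) f L r) (j := Ordinal LK)).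
exact: (bigmin_le_cond 1 (fun r : 'I_L => f L r) (j := Ordinal rL)).
Qed.

(** Serves as a pigeonhole, by contraposition: a sum at least n b has a term at least b. The strict
    bound on the size covers the empty list. *)
Lemma sum_lt_nat_mul (T : eqType) (s : seq T) (f : T -> R) (b : R) n :
  0 < b -> (size s < n)%N -> (forall z, z \in s -> f z < b) ->
  \sum_(z <- s) f z < n%:R * b.
Proof.
move=> b0 sn fb; apply: (@le_lt_trans _ _ ((size s)%:R * b)); last first.
  by rewrite ltr_pM2r// ltr_nat.
elim: s fb {sn} => [|z s IH] fb; first by rewrite big_nil mul0r.
rewrite big_cons /= -natr1 mulrDl mul1r addrC lerD//.
  by apply: IH => w ws; rewrite fb// in_cons ws orbT.
by rewrite ltW// fb ?mem_head.
Qed.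

Lemma decay_tail (zs : seq R[i]) (c : R[i] -> R[i]) (e : R) : 0 < e ->
  (forall z, z \in zs -> cabs z < 1) ->
  exists n0, forall n, (n0 <= n)%N ->
    \sum_(z <- zs) cabs (c z) * cabs z ^+ n <= e.
Proof.
elim: zs e => [|z zs IH] e e0 z1.
  by exists 0%N => n _; rewrite big_nil ltW.
have [||n1 h1] := IH (e / 2); first by rewrite divr_gt0.
  by move=> w ws; rewrite z1// in_cons ws orbT.
have e2 : 0 < e / 2 by rewrite divr_gt0.
have : (fun n => cabs (c z) * cabs z ^+ n) @ \oo --> 0.
  by apply: cvg_geometric; rewrite ger0_norm ?cabs_ge0// z1 ?mem_head.
move=> /cvgrPdist_lt/(_ _ e2)[n2 _ h2].
exists (maxn n1 n2) => n; rewrite geq_max => /andP[n1n n2n].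
rewrite big_cons.
have := h2 n n2n; rewrite /= sub0r normrN ger0_norm; last first.
  by rewrite mulr_ge0 ?exprn_ge0 ?cabs_ge0.
by have := h1 n n1n; lra.
Qed.

Lemma pi_le4 : pi <= 4 :> R.
Proof. by have [/andP[_]] := @pihalf_02_cos_pihalf R; lra. Qed.

Lemma sin2_pi_le (x : R) : sin (pi * x) ^+ 2 <= 16 * x ^+ 2.
Proof.
have h : sin (pi * x) ^+ 2 <= (pi * x) ^+ 2.
  by rewrite -[leLHS]real_normK ?num_real// -[leRHS]real_normK ?num_real//
    lerXn2r ?nnegrE// abs_sin_le.
rewrite (le_trans h)// exprMn ler_wpM2r ?sqr_ge0//.
rewrite (_ : 16 = 4 ^+ 2); last by rewrite -natrX.
by rewrite lerXn2r ?nnegrE ?pi_ge0// pi_le4.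
Qed.

Lemma sin2_pi_ge (x : R) : `|x| <= 4^-1 -> x ^+ 2 <= sin (pi * x) ^+ 2.
Proof.
move=> x4; have pi1 : `|pi * x| <= 1.
  rewrite normrM ger0_norm ?pi_ge0//.
  rewrite (le_trans (ler_pM (pi_ge0 R) (normr_ge0 x) pi_le4 x4))//.
  by rewrite mulfV.
rewrite -[leLHS]real_normK ?num_real// -[leRHS]real_normK ?num_real//.
rewrite lerXn2r ?nnegrE// (le_trans _ (abs_sin_ge pi1))//.
rewrite normrM (ger0_norm (pi_ge0 R)).
rewrite ler_pdivlMr// (mulrC `|x|); apply: ler_wpM2r => //; exact: pi_ge2.
Qed.

(* In the case of small coefficients on the unit circle, x n stays close to
   t n / L.  Otherwise a return time g of the rotation is chosen for which
   x (n + g) - x n is, modulo 1, a small exponential sum whose coefficients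
   are neither small nor large. *)
Lemma nonreturn_density (d : nat) (zs : seq R[i]) (A : R) : (0 < d)%N ->
  uniq zs -> (forall z, z \in zs -> cabs z <= 1) ->
  (forall z k, z \in zs -> (0 < k)%N -> z ^+ k != 1) ->
  exists2 rho : R, 0 < rho &
  forall (c : R[i] -> R[i]) (x : nat -> R) (t : nat -> int) (L : nat),
    (0 < L)%N -> L%:R <= A ->
    (forall n, ((t n)%:~R / L%:R - x n)%:C%C = \sum_(z <- zs) c z * z ^+ n) ->
    (exists P n1, (0 < P)%N /\
       forall n, (n1 <= n)%N -> (L%:Z %| t (n + P)%N - t n)%Z) ->
    (forall n, exists i, (i < d)%N /\ ~~ (L%:Z %| t (n + i)%N)%Z) ->
    exists N0, forall N, (N0 <= N)%N ->
      rho * N%:R <= \sum_(n < N) sin (pi * x n) ^+ 2.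
Proof.
move=> d0 uzs zs1 zsX.
have [m /andP[m0 m1] gap] := sin2_rational_gap A.
have [CV CV0 hCV] := vandermonde_bound uzs.
pose N' := (size zs).+1; have N'0 : 0 < N'%:R :> R by rewrite ltr0n.
have N'1 : 1 <= N'%:R :> R by rewrite ler1n.
(* If the coefficients on the unit circle have moduli of sum at least m / 16, one of these is at
   least B. *)
pose B := m / 16 / N'%:R.
have B0 : 0 < B by rewrite !divr_gt0.
have BN : N'%:R * B = m / 16 by rewrite /B mulrC divfK ?gt_eqF.
have B16 : B <= 16^-1.
  by rewrite /B ler_pdivrMr// ler_pdivrMr//; move: m1 N'1; lra.
(* B / N' will bound below a coefficient of y_(n+g) - y_n; dividing by [CV] gives a bound for one of
   its values, and the factor 2 makes it strict. *)
pose b := B / N'%:R / (2 * CV).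
have b0 : 0 < b by rewrite /b !divr_gt0// mulr_gt0.
pose beta := Num.min (m / 4) (b ^+ 2 / 2).
have beta0 : 0 < beta by rewrite lt_min !divr_gt0// exprn_gt0.
(* Windows of length d serve the case of small coefficients, those of length [size zs] the other
   case. *)
pose W := (d + size zs)%N.
have W0 : (0 < W)%N by rewrite addn_gt0 d0.
exists (beta / (4 * W%:R)); first by rewrite divr_gt0// mulr_gt0// ltr0n.
move=> c x t L L0 LA tx [P [n1 [P0 Pper]]] win.
pose s n := sin (pi * x n) ^+ 2.
suff [g [n0 H]] : exists g n0, forall n, (n0 <= n)%N ->
    exists i, (i < W)%N /\ beta <= s (n + i)%N + s (n + i + g)%N.
  by apply: (sum_lower_density (s := s) _ beta0 W0 H) => n; exact: sqr_ge0.
have L0' : 0 < L%:R :> R by rewrite ltr0n.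
pose y n : R := (t n)%:~R / L%:R - x n.
pose U := [seq z <- zs | cabs z == 1].
pose V := [seq z <- zs | cabs z != 1].
have UV (f : R[i] -> R) :
    \sum_(z <- zs) f z = \sum_(z <- U) f z + \sum_(z <- V) f z.
  by rewrite !big_filter (bigID (fun z => cabs z == 1)).
have V1 z : z \in V -> cabs z < 1.
  by rewrite mem_filter => /andP[zn1 zz]; rewrite lt_neqAle zn1 zs1.
have U1 z : z \in U -> cabs z = 1.
  by rewrite mem_filter => /andP[/eqP].
have Uzs z : z \in U -> z \in zs by rewrite mem_filter => /andP[].
have sU : (size U < N')%N by rewrite ltnS size_filter count_size.
have e0 : 0 < m / 64 by rewrite divr_gt0.
have [n0 tail] := decay_tail c e0 V1.
pose S := \sum_(z <- U) cabs (c z).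
have [SM|MS] := ltP S (m / 16).
  (* Here |y_n| <= m / 16 + m / 64 <= m / 8 eventually, and g = 0 is enough: where L does not divide
     t_n, the gap m leaves at least m / 4 for s_n. *)
  exists 0%N, n0 => n n0n; have [i [id' hi]] := win n.
  exists i; split; first by rewrite /W ltn_addr.
  have yle : `|y (n + i)%N| <= m / 8.
    rewrite -cabs_real tx (le_trans (cabs_sum _ _ _))// UV.
    have := tail (n + i)%N (leq_trans n0n (leq_addr _ _)).
    under [X in X <= _ -> _]eq_bigr do rewrite -cabsX -cabsM.
    have : \sum_(z <- U) cabs (c z * z ^+ (n + i)) = S.
      rewrite big_seq [RHS]big_seq; apply: eq_bigr => z zU.
      by rewrite cabsM cabsX (U1 z zU) expr1n mulr1.
    by move=> ->; move: SM; lra.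
  have := gap L (t (n + i)%N) L0 LA hi.
  rewrite (_ : (t (n + i)%N)%:~R / L%:R = x (n + i)%N + y (n + i)%N); last first.
    by rewrite /y addrC subrK.
  rewrite mulrDr => /le_trans/(_ (sin2D_le _ _)).
  have sy : sin (pi * y (n + i)%N) ^+ 2 <= m / 4.
    rewrite (le_trans (sin2_pi_le _))//.
    have : `|y (n + i)%N| ^+ 2 <= (m / 8) ^+ 2.
      by rewrite lerXn2r ?nnegrE// ltW// divr_gt0.
    by rewrite real_normK ?num_real// => h; move: m0 m1 h; rewrite !expr2; nra.
  move=> hm; rewrite addn0 /beta ge_min; apply/orP; left.
  by rewrite /s; move: hm sy; set sx := sin (pi * x _) ^+ 2; lra.
have [z1 z1U cz1] : exists2 z1, z1 \in U & B <= cabs (c z1).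
  apply: contrapT => no; have : S < N'%:R * B.
    apply: sum_lt_nat_mul => // z zU; rewrite ltNge; apply/negP => cz.
    by apply: no; exists z.
  by rewrite BN ltNge MS.
have S0 : 0 < S by rewrite (lt_le_trans _ MS)// divr_gt0.
(* Multiples of the period P keep t unchanged modulo L; the precision B / S lets [Phi] rise by at
   most B when g increases by P k. *)
have [||k k0 hk] := @dirichlet R [seq z ^+ P | z <- U] (B / S).
- by rewrite divr_gt0.
- by move=> _ /mapP[w wU ->]; rewrite cabsX (U1 w wU) expr1n.
(* Total size of the unit-circle coefficients of y_(n+g) - y_n. *)
pose Phi g := \sum_(z <- U) cabs (c z) * cabs (z ^+ g - 1).
pose k0' := (P * k)%N.
have PhiS j : Phi (k0' * j.+1)%N <= Phi (k0' * j)%N + B.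
  have step z : z \in U -> cabs (z ^+ (k0' * j.+1) - 1) <=
      cabs (z ^+ (k0' * j) - 1) + B / S.
    move=> zU; rewrite mulnS exprD.
    rewrite (_ : _ - 1 = z ^+ k0' * (z ^+ (k0' * j) - 1) + (z ^+ k0' - 1)); last by ring.
    rewrite (le_trans (cabsD _ _))// cabsM cabsX (U1 z zU) expr1n mul1r lerD2l.
    by rewrite /k0' exprM ltW// hk//; apply/mapP; exists z.
  rewrite (_ : B = S * (B / S)); last by rewrite mulrC divfK// gt_eqF.
  rewrite /Phi /S mulr_suml -big_split/= big_seq [leRHS]big_seq.
  apply: ler_sum => z zU; rewrite -mulrDr ler_wpM2l ?cabs_ge0//.
  exact: step.
(* Since z1 is not a root of unity, some power of z1^(P k) is at distance at least 1 from 1. *)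
have [J hJ] : exists J, B <= Phi (k0' * J)%N.
  have kP : (0 < k0')%N by rewrite muln_gt0 P0.
  have [||J hJ] := @exists_expr_far R (z1 ^+ k0').
  - by rewrite cabsX (U1 z1 z1U) expr1n.
  - by rewrite zsX// Uzs.
  exists J; rewrite /Phi (big_rem z1)//= exprM.
  apply: (@le_trans _ _ (cabs (c z1) * cabs (z1 ^+ k0' ^+ J - 1))).
    by rewrite (le_trans cz1)// ler_peMr ?cabs_ge0.
  by rewrite lerDl; apply: sumr_ge0 => z _; rewrite mulr_ge0 ?cabs_ge0.
(* Discrete intermediate values: [Phi] starts at 0, reaches B and rises by at most B at a time, so
   it takes a value between B and 2 B. *)
have [j [hj1 hj2]] : exists j, B <= Phi (k0' * j)%N /\ Phi (k0' * j)%N <= 2 * B.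
  elim: J hJ => [|J IH] hJ.
    exfalso; move: hJ; rewrite muln0 /Phi big1 ?leNgt ?B0// => z _.
    by rewrite expr0 subrr cabs0 mulr0.
  have [/IH//|lt] := leP B (Phi (k0' * J)%N).
  exists J.+1; split=> //; have := PhiS J; move: lt; lra.
pose g := (k0' * j)%N; exists g, (maxn n0 n1) => n.
rewrite geq_max => /andP[n0n n1n].
pose D n := y (n + g)%N - y n.
have DE l : (D l)%:C%C = \sum_(z <- zs) c z * (z ^+ g - 1) * z ^+ l.
  rewrite /D rmorphB/= /y !tx -sumrB; apply: eq_bigr => z _.
  by rewrite exprD; ring.
(* The sum of 2 B <= 1/8 and of twice the tail is at most 1/4, the range where sin^2(pi x) >=
   x^2. *)
have Dle l : (n <= l)%N -> `|D l| <= 4^-1.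
  move=> nl; rewrite -cabs_real DE (le_trans (cabs_sum _ _ _))// UV.
  have -> : \sum_(z <- U) cabs (c z * (z ^+ g - 1) * z ^+ l) = Phi g.
    rewrite big_seq /Phi [RHS]big_seq; apply: eq_bigr => z zU.
    by rewrite !cabsM cabsX (U1 z zU) expr1n mulr1.
  have : \sum_(z <- V) cabs (c z * (z ^+ g - 1) * z ^+ l) <=
      2 * \sum_(z <- V) cabs (c z) * cabs z ^+ l.
    rewrite mulr_sumr big_seq [leRHS]big_seq; apply: ler_sum => z zV.
    rewrite !cabsM cabsX mulrA ler_wpM2r ?exprn_ge0 ?cabs_ge0// mulrC.
    rewrite ler_wpM2r ?cabs_ge0// (le_trans (cabsB _ _))// cabs1.
    have : cabs (z ^+ g) <= 1 by rewrite cabsX exprn_ile1 ?cabs_ge0// ltW// V1.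
    by lra.
  have := tail l (leq_trans n0n nl).
  by rewrite -/g in hj2; move: hj2 B16 m1; lra.
(* As P divides g, D_l differs from x_l - x_(l+g) by an integer. *)
have sD l : (n <= l)%N -> D l ^+ 2 <= 2 * (s l + s (l + g)%N).
  move=> nl; rewrite (le_trans (sin2_pi_ge (Dle l nl)))//.
  have per i : (L%:Z %| t (l + P * i)%N - t l)%Z.
    elim: i => [|i IH]; first by rewrite muln0 addn0 subrr dvdz0.
    rewrite mulnSr addnA -(subrK (t (l + P * i)%N) (t (l + P * i + P)%N)).
    rewrite -addrA rpredD//.
    by apply: Pper; rewrite (leq_trans n1n)// (leq_trans nl)// leq_addr.
  have /dvdzP[q qE] : (L%:Z %| t (l + g)%N - t l)%Z.
    by rewrite /g /k0' -mulnA; exact: per.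
  have -> : D l = - x (l + g)%N + x l + q%:~R.
    rewrite /D /y; have := congr1 (fun u : int => u%:~R / L%:R : R) qE.
    rewrite intrM rmorphB/= mulfK ?gt_eqF// => <-.
    by rewrite mulrBl; ring.
  rewrite sin2_piDint mulrDr (le_trans (sin2D_le _ _))//.
  by rewrite mulrN sinN sqrrN /s addrC mulrDr.
have [z zU ez] : exists2 z, z \in U & B / N'%:R <= cabs (c z * (z ^+ g - 1) * z ^+ n).
  apply: contrapT => no; have : Phi g < N'%:R * (B / N'%:R).
    apply: sum_lt_nat_mul => [|//|z zU]; first by rewrite divr_gt0.
    rewrite ltNge; apply/negP => cz.
    apply: no; exists z => //.
    by rewrite !cabsM cabsX (U1 z zU) expr1n mulr1.
  by rewrite mulrC divfK ?gt_eqF// ltNge hj1.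
(* Otherwise D would be small at [size zs] successive times, and by [hCV] so would its coefficient
   at z. *)
have [i iz Di] : exists2 i, (i < size zs)%N & b < `|D (n + i)%N|.
  apply: contrapT => no.
  have : cabs (c z * (z ^+ g - 1) * z ^+ n) <= CV * b.
    apply: (hCV (fun z => c z * (z ^+ g - 1) * z ^+ n)); last exact: Uzs.
    move=> i iz; under eq_bigr do rewrite -mulrA -exprD.
    rewrite -DE cabs_real leNgt; apply/negP => hi.
    by apply: no; exists i.
  rewrite leNgt; apply/negP; rewrite negbK.
  apply: lt_le_trans ez; rewrite /b.
  rewrite (_ : CV * _ = B / N'%:R / 2); last by field; rewrite !gt_eqF.
  have : 0 < B / N'%:R by rewrite divr_gt0.
  by lra.
exists i; split; first by rewrite /W ltn_addl.
have h := sD (n + i)%N (leq_addr _ _).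
rewrite /beta ge_min; apply/orP; right.
have : b ^+ 2 <= D (n + i)%N ^+ 2.
  by rewrite -[leRHS]real_normK ?num_real// lerXn2r ?nnegrE// ltW.
by move: h; lra.
Qed.

End Density.

(** * Power sums and traces *)

Section LinearRecurrence.
Variables (d : nat) (t : nat -> int) (a : 'I_d -> int).
Hypothesis t_rec : forall n, t (n + d)%N = \sum_(i < d) a i * t (n + i)%N.

(** Pigeonhole: two vectors of d successive residues modulo L coincide, and the recurrence
    propagates the coincidence. *)
Lemma linear_recurrence_periodic (L : nat) : (0 < L)%N ->
  exists P n1, (0 < P)%N /\
    forall n, (n1 <= n)%N -> (L%:Z %| t (n + P)%N - t n)%Z.
Proof.
move=> L0.
have Ln0 : L%:Z != 0 by rewrite eqz_nat -lt0n.
have modL x : (`|(x %% L)%Z| < L)%N.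
  by rewrite -ltz_nat gez0_abs ?modz_ge0// ltz_pmod.
pose state n : {ffun 'I_d -> 'I_L} := [ffun i : 'I_d => Ordinal (modL (t (n + i)%N))].
pose K := #|{: {ffun 'I_d -> 'I_L}}|.
have /injectivePn[n1 [n2 n12 E]] : ~~ injectiveb (fun i : 'I_K.+1 => state i).
  by apply/negP => /injectiveP/leq_card; rewrite card_ord -/K ltnn.
wlog lt12 : n1 n2 n12 E / (n1 < n2)%N.
  move=> H; case: (ltngtP n1 n2) => [|lt|/val_inj e]; first exact: H.
    by apply: (H n2 n1) => //; rewrite eq_sym.
  by rewrite e eqxx in n12.
exists (n2 - n1)%N, n1; split; first by rewrite subn_gt0.
have step m : (L%:Z %| t (n2 + m)%N - t (n1 + m)%N)%Z.
  elim/ltn_ind: m => m IH; have [md|dm] := ltnP m d.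
    have /ffunP/(_ (Ordinal md)) := E.
    rewrite !ffunE => /(congr1 val)/= /(congr1 Posz); rewrite !gez0_abs ?modz_ge0// => e.
    by rewrite -eqz_mod_dvd; apply/eqP.
  rewrite -(subnK dm) !addnA !t_rec -sumrB.
  apply: rpred_sum => i _; rewrite -mulrBr dvdz_mull//.
  rewrite -!addnA; apply: IH; have := ltn_ord i; lia.
move=> n n1n; have := step (n - n1)%N.
by congr (_ %| t _ - t _)%Z; lia.
Qed.

(** As a_0 is invertible, the recurrence runs backwards: d successive multiples of L would make t_0,
    ..., t_(d-1) multiples of L. *)
Lemma linear_recurrence_window (L : nat) (d0 : (0 < d)%N) :
  a (Ordinal d0) \in GRing.unit ->
  (exists2 n : 'I_d, true & ~~ (L%:Z %| t n)%Z) ->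
  forall n, exists i, (i < d)%N /\ ~~ (L%:Z %| t (n + i)%N)%Z.
Proof.
move=> a0 [n0 _ tn0] n; apply: contrapT => /forallNP H.
have {}H i : (i < d)%N -> (L%:Z %| t (n + i)%N)%Z.
  by move=> id'; apply: contrapT => /negP h; apply: (H i); split.
suff /(_ n0 (ltn_ord n0)) : forall i, (i < d)%N -> (L%:Z %| t (0 + i)%N)%Z.
  by rewrite add0n; apply/negP.
elim: n H => // n IH H; apply: IH => i id'.
case: i id' => [_|i id']; last by rewrite addnS -addSn; apply: H; exact: ltnW.
rewrite addn0.
have := t_rec n; rewrite (bigD1 (Ordinal d0))//= addn0 => /esym/eqP.
rewrite eq_sym -subr_eq => /eqP E.
have : (L%:Z %| a (Ordinal d0) * t n)%Z.
  rewrite -E rpredB//.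
    have -> : (n + d = n.+1 + d.-1)%N by lia.
    by apply: H; rewrite ltn_predL.
  apply: rpred_sum => i i0; rewrite dvdz_mull//.
  have i1 : (0 < i)%N by rewrite lt0n; apply: contra i0 => /eqP i0; apply/eqP/val_inj.
  have -> : (n + i = n.+1 + i.-1)%N by lia.
  by apply: H; have := ltn_ord i; lia.
by move=> /(dvdz_mull (a (Ordinal d0))^-1); rewrite mulKr.
Qed.

End LinearRecurrence.

Section PowerSums.
Context {F : fieldType}.

Lemma deriv_prod_XsubC (rs : seq F) :
  (\prod_(z <- rs) ('X - z%:P))^`() =
  \sum_(z <- rs) (\prod_(w <- rs) ('X - w%:P)) %/ ('X - z%:P).
Proof.
elim: rs => [|a rs IH]; first by rewrite !big_nil derivC.
rewrite !big_cons derivM derivXsubC mul1r IH.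
rewrite mulKp ?polyXsubC_eq0//; congr (_ + _).
rewrite mulr_sumr big_seq [RHS]big_seq; apply: eq_bigr => z zrs.
by rewrite divp_mulA// dvdp_XsubCl root_prod_XsubC.
Qed.

(** Synthetic division: q_j = p_(j+1) + z q_(j+1), unrolled from the leading coefficient. *)
Lemma coef_div_XsubC (p : {poly F}) z d m : root p z -> size p = d.+1 ->
  (m <= d)%N ->
  (p %/ ('X - z%:P))`_(d - m) = \sum_(i < m) p`_(d - m + 1 + i) * z ^+ i.
Proof.
move=> pz sp; set q := p %/ _.
have pE : p = ('X - z%:P) * q by rewrite mulrC divpK// dvdp_XsubCl.
have qS j : q`_j = p`_j.+1 + z * q`_j.+1.
  by rewrite [in RHS]pE mulrBl coefB coefXM coefCM/= subrK.
elim: m => [_|m IH md].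
  rewrite subn0 big_ord0 nth_default// /q size_divp ?polyXsubC_eq0//.
  by rewrite size_XsubC sp subn1.
rewrite qS (_ : (d - m.+1).+1 = d - m)%N; last by lia.
rewrite IH ?(ltnW md)// big_ord_recl expr0 mulr1 mulr_sumr; congr (_ + _).
  by congr (p`_ _) => /=; lia.
apply: eq_bigr => i _; rewrite mulrCA -exprS; congr (p`_ _ * _).
by rewrite /= /bump/=; lia.
Qed.

(* Newton's identities: compare the coefficients of p' = sum of p / (X - z). *)
Lemma power_sum_int (rs : seq F) (P : {poly int}) :
  P \is monic -> map_poly intr P = \prod_(z <- rs) ('X - z%:P) ->
  forall k, exists n : int, \sum_(z <- rs) z ^+ k = n%:~R.
Proof.
move=> Pm; set p := map_poly _ P => pE; pose d := size rs.
have sp : size p = d.+1 by rewrite pE size_prod_XsubC.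
have pc i : p`_i = (P`_i)%:~R by rewrite coef_map.
have pd : p`_d = 1.
  have := monic_prod_XsubC rs xpredT id; rewrite -pE => /monicP.
  by rewrite lead_coefE sp.
have rp z : z \in rs -> root p z by rewrite pE root_prod_XsubC.
elim/ltn_ind => k IH.
have sub_int (m : nat) (c j : nat -> nat) : (forall i, (i < m)%N -> (j i < k)%N) ->
    exists n : int, \sum_(i < m) p`_(c i) * (\sum_(z <- rs) z ^+ j i) = n%:~R.
  move=> jk; elim: m jk => [|m IHm] jk; first by exists 0; rewrite big_ord0.
  have [|n1 n1E] := IHm; first by move=> i im; apply: jk; exact: ltnW.
  have [n2 n2E] := IH _ (jk m (ltnSn m)).
  exists (n1 + P`_(c m) * n2).
  by rewrite big_ord_recr/= n1E n2E pc rmorphD rmorphM.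
(* For k < d, the power sum of order k enters the coefficient of index d - k - 1 with factor p_d =
   1, so nothing is divided. *)
have [kd|dk] := ltnP k d.
  have := congr1 (fun q : {poly F} => q`_(d - k.+1)) (deriv_prod_XsubC rs).
  rewrite -pE coef_deriv coef_sum (_ : (d - k.+1).+1 = d - k)%N; last by lia.
  rewrite big_seq; under eq_bigr => z zrs do
    rewrite (coef_div_XsubC (rp z zrs) sp kd).
  rewrite -big_seq exchange_big/=.
  under eq_bigr do rewrite -mulr_sumr.
  rewrite big_ord_recr/= (_ : d - k.+1 + 1 + k = d)%N; last by lia.
  rewrite pd mul1r => E.
  have [n nE] := sub_int k (fun i => d - k.+1 + 1 + i)%N id (fun i ik => ik).
  exists (P`_(d - k) *+ (d - k) - n).
  by rewrite rmorphB rmorphMn/= -pc E nE [RHS]addrC addKr.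
(* For k >= d, the equation P(z) = 0 expresses z^k through lower powers. *)
have zk z : z \in rs -> z ^+ k = - \sum_(i < d) p`_i * z ^+ (k - d + i).
  move=> /rp/rootP; rewrite horner_coef sp big_ord_recr/= pd mul1r.
  move=> /(congr1 (fun u => z ^+ (k - d) * u)); rewrite mulr0 mulrDr -exprD subnK//.
  move=> /eqP; rewrite addrC addr_eq0 => /eqP ->; rewrite mulr_sumr; congr (- _).
  by apply: eq_bigr => i _; rewrite mulrCA exprD.
have [n nE] := sub_int d id (fun i => k - d + i)%N ltac:(lia).
exists (- n); rewrite rmorphN/= -nE big_seq (eq_bigr _ zk) -big_seq sumrN exchange_big/=.
by congr (- _); apply: eq_bigr => i _; rewrite mulr_sumr.
Qed.

End PowerSums.

(** * Minimal polynomials, embeddings and the trace *)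

Section MinimalPolynomial.
Context {R : realType}.
Local Notation C := R[i].
Local Notation ev q z := (map_poly ratr q).[z].

(** A common root rules out coprimality, and a nontrivial gcd with P is associate to P. *)
Lemma irreducible_dvdp (F : numFieldType) (P Q : {poly rat}) (x : F) :
  irreducible_poly P -> root (map_poly ratr P) x -> root (map_poly ratr Q) x ->
  P %| Q.
Proof.
move=> [_ irr] Px Qx.
have [cop|ncop] := boolP (coprimep P Q).
  have := coprimep_map (@ratr F) P Q; rewrite cop => cop'.
  by have := coprimep_root cop' Px; rewrite -/(root _ _) Qx.
have g1 : size (gcdp P Q) != 1%N by [].
by rewrite -(eqp_dvdl _ (irr _ g1 (dvdp_gcdl _ _))) dvdp_gcdr.
Qed.

(** Otherwise P would divide its nonzero derivative, of smaller degree. *)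
Lemma irreducible_separable (P : {poly rat}) :
  irreducible_poly P -> separable_poly P.
Proof.
move=> [P1 irr]; rewrite unlock; apply: contraT => ncop.
have g1 : size (gcdp P P^`()) != 1%N by [].
have : P %| P^`().
  by rewrite -(eqp_dvdl _ (irr _ g1 (dvdp_gcdl _ _))) dvdp_gcdr.
have P0 : P != 0 by rewrite -size_poly_gt0 ltnW.
have P'0 : P^`() != 0.
  have [n Pn] : exists n, size P = n.+2.
    by exists (size P).-2; case: (size P) P1 => [|[]].
  apply/eqP => /(congr1 (fun q : {poly rat} => q`_n)).
  rewrite coef_deriv coef0 -[n.+1]/(n.+2.-1) -Pn -lead_coefE => /eqP.
  by rewrite mulrn_eq0 lead_coef_eq0 (negbTE P0) orbF Pn.
by move=> /(dvdp_leq P'0); rewrite leqNgt lt_size_deriv.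
Qed.

Variables (alpha : R) (P : {poly rat}).
Hypothesis minP : is_minpoly alpha P.

Let Pirr : irreducible_poly P. Proof. by case: minP. Qed.
Let Proot : root (map_poly ratr P) alpha. Proof. by case: minP. Qed.

Lemma minpoly_roots : exists2 rs : seq C, uniq rs &
  map_poly ratr P = \prod_(z <- rs) ('X - z%:P).
Proof.
have [rs rsE] := closed_field_poly_normal (map_poly (ratr : rat -> C) P).
have lc : lead_coef (map_poly (ratr : rat -> C) P) = 1.
  by rewrite lead_coef_map; case: minP => /monicP -> _ _; rewrite rmorph1.
rewrite lc scale1r in rsE; exists rs => //.
by rewrite -separable_prod_XsubC -rsE separable_map irreducible_separable.
Qed.

Lemma ev_complex (q : {poly rat}) : ((ev q alpha)%:C)%C = ev q (alpha%:C)%C.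
Proof.
rewrite -(horner_map (real_complex R)) -map_poly_comp.
by congr (_ .[_]); apply: eq_map_poly => c; exact: fmorph_rat.
Qed.

(** P divides q - q'. Thus evaluation at the root z is a well-defined function of the number
    q(alpha). *)
Lemma ev_minpoly_root (q q' : {poly rat}) (z : C) :
  root (map_poly ratr P) z -> ev q alpha = ev q' alpha -> ev q z = ev q' z.
Proof.
move=> Pz qq'.
have Pd : P %| q - q'.
  apply: (irreducible_dvdp Pirr Proot).
  by rewrite rmorphB rootE !hornerE qq' subrr.
have : root (map_poly ratr (q - q')) z.
  by rewrite -(divpK Pd) rmorphM rootM Pz orbT.
by rewrite rmorphB rootE !hornerE subr_eq0 => /eqP.
Qed.

Lemma QadjoinP eta : Qadjoin alpha eta <-> exists q : {poly rat}, eta = ev q alpha.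
Proof.
split=> [[p [q ->]]|[q ->]]; last first.
  by exists q, 1; rewrite rmorph1 hornerC divr1.
(* With x / 0 = 0 the quotient is 0, the value of the zero polynomial. *)
have [q0|q0] := eqVneq (ev q alpha) 0.
  by exists 0; rewrite q0 invr0 mulr0 rmorph0 horner0.
have : coprimep q P.
  rewrite coprimep_sym; apply: contraT => ncop.
  have g1 : size (gcdp P q) != 1%N by [].
  have Pq : P %| q.
    by rewrite -(eqp_dvdl _ (Pirr.2 _ g1 (dvdp_gcdl _ _))) dvdp_gcdr.
  case/eqP: q0; rewrite -(divpK Pq) rmorphM hornerM.
  by rewrite (rootP Proot) mulr0.
move=> /Bezout_eq1_coprimepP[[u v] /= uE].
exists (p * u).
have := congr1 (fun r => ev r alpha) uE.
rewrite rmorphD !rmorphM rmorph1/= !hornerE (rootP Proot) mulr0 addr0 => uq.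
by congr (_ * _); apply: (mulIf q0); rewrite mulVf.
Qed.

Lemma Qadjoin_ev (q : {poly rat}) : Qadjoin alpha (ev q alpha).
Proof. by apply/QadjoinP; exists q. Qed.

(** The embedding sending alpha to z, extended by 0. For a root z of P the chosen polynomial does
    not matter, by [ev_minpoly_root]. *)
Let emb (z : C) (eta : R) : C :=
  if pselect (exists q : {poly rat}, eta = ev q alpha) is left e
  then ev (sval (cid e)) z else 0.

Let embE z q : root (map_poly ratr P) z -> emb z (ev q alpha) = ev q z.
Proof.
move=> Pz; rewrite /emb; case: pselect => [e|[]]; last by exists q.
by apply: ev_minpoly_root => //; rewrite -(svalP (cid e)).
Qed.

Let emb_embedding z : root (map_poly ratr P) z -> embeddings alpha (emb z).
Proof.
move=> Pz; split.
- have := @embE z 1 Pz; by rewrite !rmorph1 !hornerC.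
- move=> x y; rewrite !inE => /QadjoinP[q ->] /QadjoinP[q' ->].
  by rewrite -hornerD -rmorphD !embE// rmorphD hornerD.
- move=> x y; rewrite !inE => /QadjoinP[q ->] /QadjoinP[q' ->].
  by rewrite -hornerM -rmorphM !embE// rmorphM hornerM.
- by move=> x xQ; rewrite /emb; case: pselect => // e; case: xQ; exact/QadjoinP.
Qed.

(** On the rationals s is a ring morphism, hence the canonical one; the rest is induction on q. *)
Let embedding_ev s q : embeddings alpha s -> s (ev q alpha) = ev q (s alpha).
Proof.
move=> [s1 sD sM _].
have Q_ q' : ev q' alpha \in Qadjoin alpha by rewrite inE; exact: Qadjoin_ev.
pose f (c : rat) : C := s (ratr c).
have fE c : f c = s (ev c%:P alpha) by rewrite map_polyC/= hornerC.
have f_add : zmod_morphism f.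
  have fD x y : f (x + y) = f x + f y.
    by rewrite !fE polyCD rmorphD hornerD sD ?Q_.
  have fB x y : f (x - y) + f y = f x by rewrite -fD subrK.
  by move=> x y; rewrite -(fB x y) addrK.
have f_mul : monoid_morphism f.
  split; first by rewrite /f rmorph1.
  by move=> x y; rewrite !fE polyCM rmorphM hornerM sM ?Q_.
pose fA := GRing.isZmodMorphism.Build _ _ f f_add.
pose fM := GRing.isMonoidMorphism.Build _ _ f f_mul.
pose fm : {rmorphism rat -> C} := HB.pack f fA fM.
have fr c : f c = ratr c by exact: (fmorph_eq_rat fm).
have alphaE : alpha = ev 'X alpha by rewrite map_polyX hornerX.
elim/poly_ind: q => [|q c IH].
  by have := fr 0; rewrite fE polyC0 !rmorph0 !horner0.
rewrite !rmorphD !rmorphM/= !hornerD !hornerM map_polyX !hornerX sD; last 2 first.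
- by rewrite {2}alphaE -hornerM -rmorphM Q_.
- exact: Q_.
rewrite sM ?Q_//; last by rewrite {1}alphaE Q_.
by rewrite IH -fE fr map_polyC/= hornerC map_polyX hornerX.
Qed.

(** [emb] is a bijection from the roots of P onto the embeddings, with inverse the evaluation at
    alpha. *)
Lemma trace_ev (rs : seq C) (q : {poly rat}) : uniq rs ->
  map_poly ratr P = \prod_(z <- rs) ('X - z%:P) ->
  trace alpha (ev q alpha) = \sum_(z <- rs) ev q z.
Proof.
move=> urs PE; rewrite /trace.
have rsP z : z \in rs -> root (map_poly ratr P) z by rewrite PE root_prod_XsubC.
have alphaE : alpha = ev 'X alpha by rewrite map_polyX hornerX.
rewrite (@reindex_fsbig _ _ _ C (R -> C) emb [set` rs]); last first.
  split.
  - by move=> z /= /rsP; exact: emb_embedding.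
  - move=> z w; rewrite !inE /= => /rsP Pz /rsP Pw /(congr1 (fun s => s alpha)).
    by rewrite alphaE !embE// map_polyX !hornerX.
  - move=> s sE; have ss := embedding_ev _ sE; exists (s alpha).
      rewrite /= -root_prod_XsubC -PE; apply/rootP.
      rewrite -ss (rootP Proot).
      by have := ss 0; rewrite !rmorph0 !horner0.
    have Ps : root (map_poly ratr P) (s alpha).
      apply/rootP; rewrite -ss (rootP Proot).
      by have := ss 0; rewrite !rmorph0 !horner0.
    apply/funext => x; have [/QadjoinP[r ->]|xQ] := pselect (Qadjoin alpha x).
      by rewrite embE// ss.
    have [_ _ _ ->] := emb_embedding Ps; last by [].
    by have [_ _ _ ->] := sE.
rewrite -fsbig_seq// big_seq [RHS]big_seq; apply: eq_bigr => z /rsP Pz.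
by rewrite embE.
Qed.

End MinimalPolynomial.

(** * Salem numbers *)

Section Salem.
Context {R : realType}.
Local Notation C := R[i].

(* A conjugate z on the unit circle satisfies z^-1 = z^*, so it is a root of
   both P and the reciprocal polynomial of P, which are thus proportional. *)
Lemma salem_coef0 (alpha : R) (P : {poly rat}) (z : C) :
  is_minpoly alpha P -> root (map_poly ratr P) z -> `|z| = 1 ->
  P`_0 ^+ 2 = 1.
Proof.
move=> [Pm Pirr _] Pz z1.
have [P1 _] := Pirr.
have z0 : z != 0 by rewrite -normr_eq0 z1 oner_neq0.
pose n := (size P).-1.
have sP : size P = n.+1 by rewrite prednK// ltnW.
pose Q : {poly rat} := \poly_(i < n.+1) P`_(n - i).
have zJ : z^-1 = z^*%C by rewrite invc_norm z1 expr1n invr1 mul1r.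
have Pzi : root (map_poly ratr P) z^-1.
  rewrite zJ -complex_root_conj -map_poly_comp.
  by rewrite (eq_map_poly (fun c => fmorph_rat (@conjc R) c)).
have Qzi : root (map_poly ratr Q) z^-1.
  apply/rootP; rewrite (@horner_coef_wide _ n.+1); last first.
    by rewrite (leq_trans (size_poly _ _))// size_poly.
  have /rootP := Pz; rewrite horner_coef size_map_poly sP => E.
  apply: (mulfI (expf_neq0 n z0)); rewrite mulr0 -[RHS]E mulr_sumr.
  rewrite (reindex_inj rev_ord_inj)/=; apply: eq_bigr => i _.
  rewrite !coef_map coef_poly subSS ltnS leq_subr.
  have iP : (i <= n)%N by rewrite -ltnS.
  rewrite subKn// mulrCA exprVn; congr (_ * _).
  have -> : z ^+ n = z ^+ i * z ^+ (n - i) by rewrite -exprD subnKC.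
  by rewrite mulfK// expf_neq0.
have Q0 : Q`_0 = 1.
  by rewrite coef_poly /= subn0 -[n]/(n.+1.-1) -sP -lead_coefE; apply/monicP.
have Qn0 : Q != 0 by apply/eqP => Q00; move: Q0; rewrite Q00 coef0 => /eqP; rewrite eq_sym oner_eq0.
have PQ : P %| Q by exact: irreducible_dvdp Pirr Pzi Qzi.
have : size P = size Q.
  by apply/eqP; rewrite eqn_leq dvdp_leq//= sP size_poly.
move/eqP; rewrite (dvdp_size_eqp PQ) => /eqpP[[c1 c2] /= /andP[c10 c20] E].
have := congr1 (fun q : {poly rat} => q`_0) E.
have := congr1 (fun q : {poly rat} => q`_n) E.
rewrite !coefZ Q0 mulr1 coef_poly ltnSn subnn.
have -> : P`_n = 1 by rewrite -[n]/(n.+1.-1) -sP -lead_coefE; apply/monicP.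
rewrite mulr1 => -> E2; apply: (mulfI c20).
by rewrite expr2 mulrA E2 mulr1.
Qed.

Lemma eigenvalue_int_poly (F : numFieldType) (d : nat) (M : 'M[nat]_d) (x : F) :
  eigenvalue (map_mx (fun n => n%:R : F) M) x ->
  root (map_poly ratr (map_poly intr (char_poly (map_mx Posz M)) : {poly rat})) x.
Proof.
rewrite eigenvalue_root_char; congr (root _ x).
rewrite -map_poly_comp (eq_map_poly (g := intr)); last by move=> c /=; rewrite ratr_int.
rewrite map_char_poly; congr char_poly.
by apply/matrixP => i j; rewrite !mxE.
Qed.

(** The characteristic polynomial of M is monic of degree d and a multiple of P, hence equal to P.
    So the t_n = Tr(L eta alpha^n) are integers with an integral recurrence, and [nonreturn_density]
    applies to the conjugates other than alpha. *)
Lemma salem_density (d : nat) (M : 'M[nat]_d) (alpha : R) (d_gt0 : (0 < d)%N)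
    (alpha_eig : eigenvalue (map_mx (fun n => n%:R : R) M) alpha)
    (alpha_salem : is_salem alpha) (alpha_deg : has_degree alpha d) (A : R) :
  exists2 rho : R, 0 < rho &
  forall (eta : R) (L : nat) (l : 'I_d -> int),
    reduced_form alpha eta L l ->
    (exists n : 'I_d, ~ exists k : int,
       trace alpha (L%:R * eta * alpha ^+ n) = (k * L%:Z)%:~R) ->
    L%:R <= A ->
    exists N0, forall N, (N0 <= N)%N ->
      rho * N%:R <= \sum_(n < N) sin (pi * (eta * alpha ^+ n)) ^+ 2.
Proof.
have [_ alpha1 conj_le [u [[Pu minPu Pu_root] u_neq u1]]] := alpha_salem.
have [P minP sP] := alpha_deg.
have [Pm Pirr Proot] := minP.
pose aC : C := alpha%:C%C.
pose Pz := char_poly (map_mx Posz M).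
have PzE : map_poly intr Pz = P.
  have Pzm : map_poly intr Pz \is @monic rat by rewrite monic_map// char_poly_monic.
  have PPz : P %| map_poly intr Pz.
    exact: irreducible_dvdp Pirr Proot (eigenvalue_int_poly alpha_eig).
  apply/esym/eqP; rewrite -(eqp_monic Pm Pzm) -(dvdp_size_eqp PPz) sP.
  by rewrite size_map_poly_id0 ?size_char_poly// (monicP (char_poly_monic _)) rmorph1 oner_eq0.
have PuE : Pu = P.
  have [Pum Puirr Pur] := minPu.
  apply/eqP; rewrite -(eqp_monic Pum Pm) /eqp.
  by rewrite (irreducible_dvdp Puirr Pur Proot) (irreducible_dvdp Pirr Proot Pur).
have [rs urs rsE] := minpoly_roots minP.
have rsP z : (z \in rs) = root (map_poly ratr P) z by rewrite rsE root_prod_XsubC.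
have a_rs : aC \in rs.
  by rewrite rsP /root -ev_complex (rootP Proot).
pose zs := rem aC rs.
have zsE z : (z \in zs) = (z != aC) && (z \in rs) by rewrite mem_rem_uniq.
have uzs : uniq zs by exact: rem_uniq.
have zs1 z : z \in zs -> cabs z <= 1.
  rewrite zsE rsP => /andP[za Pz'].
  by rewrite -lecR cabsE conj_le//; exists P.
(* If a conjugate were a root of unity, P would divide some X^k - 1, although alpha > 1 is a root of
   P. *)
have zsX z k : z \in zs -> (0 < k)%N -> z ^+ k != 1.
  rewrite zsE rsP => /andP[_ Pz'] k0; apply/eqP => zk.
  have evX (F : numFieldType) (x : F) :
      root (map_poly ratr ('X^k - 1 : {poly rat})) x = (x ^+ k == 1).
    by rewrite rmorphB rmorph1/= map_polyXn rootE !hornerE subr_eq0.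
  have /divpK PX : P %| 'X^k - 1.
    by apply: (irreducible_dvdp Pirr Pz'); rewrite evX zk.
  have : root (map_poly ratr ('X^k - 1 : {poly rat})) alpha.
    by rewrite -PX rmorphM rootM Proot orbT.
  by rewrite evX gt_eqF// exprn_egt1// -lt0n.
have [rho rho0 H] := @nonreturn_density R d zs A d_gt0 uzs zs1 zsX.
exists rho => // eta L l [L0 etaE _] tr LA.
have Ln0 : L%:R != 0 :> R by rewrite pnatr_eq0 -lt0n.
have Pz_monic : Pz \is monic by exact: char_poly_monic.
have PzC : map_poly intr Pz = \prod_(z <- rs) ('X - z%:P) :> {poly C}.
  rewrite -rsE -PzE -map_poly_comp; apply: eq_map_poly => c /=.
  by rewrite ratr_int.
have /choice[s sE] := power_sum_int Pz_monic PzC.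
pose lz (z : C) : C := \sum_(i < d) (l i)%:~R * z ^+ i.
(* Tr(L eta alpha^n), written with the integral power sums of the conjugates. *)
pose t n : int := \sum_(i < d) l i * s (i + n)%N.
have tE n : (t n)%:~R = \sum_(z <- rs) lz z * z ^+ n :> C.
  rewrite /t rmorph_sum/=; under eq_bigr do rewrite rmorphM/= -sE mulr_sumr.
  rewrite exchange_big/=; apply: eq_bigr => z _; rewrite /lz mulr_suml.
  by apply: eq_bigr => i _; rewrite exprD mulrA.
pose a (i : 'I_d) : int := - Pz`_i.
have rec z n : z \in rs -> z ^+ (n + d) = \sum_(i < d) (a i)%:~R * z ^+ (n + i).
  rewrite rsP -PzE -map_poly_comp.
  rewrite (eq_map_poly (g := intr)); last by move=> c /=; rewrite ratr_int.
  move=> /rootP; rewrite (@horner_coef_wide _ d.+1); last first.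
    by rewrite (leq_trans (size_poly _ _))// size_char_poly.
  rewrite big_ord_recr/= coef_map/=.
  have -> : Pz`_d = 1.
    by have /monicP := Pz_monic; rewrite lead_coefE size_char_poly.
  rewrite mul1r => /eqP; rewrite addrC addr_eq0 => /eqP zd.
  rewrite exprD zd mulrN mulr_sumr -sumrN; apply: eq_bigr => i _.
  by rewrite coef_map rmorphN exprD mulrCA mulNr.
have t_rec n : t (n + d)%N = \sum_(i < d) a i * t (n + i)%N.
  apply: (@intr_inj C); rewrite tE rmorph_sum/=.
  under [RHS]eq_bigr do rewrite rmorphM/= tE mulr_sumr.
  rewrite exchange_big/= big_seq [RHS]big_seq; apply: eq_bigr => z zr.
  rewrite rec// mulr_sumr; apply: eq_bigr => i _; exact: mulrCA.
(* The conjugate u on the unit circle forces the constant coefficient to be 1 or -1. *)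
have a0 : a (Ordinal d_gt0) \in GRing.unit.
  have := salem_coef0 minP (z := u); rewrite -PuE => /(_ Pu_root u1).
  rewrite PuE -PzE coef_map => /eqP.
  rewrite -rmorphXn/= -(rmorph1 (intr : int -> rat)) (inj_eq (@intr_inj rat)) => /eqP E.
  apply/unitrP; exists (a (Ordinal d_gt0)).
  by rewrite /a mulrNN -expr2 E.
have win : forall n, exists i, (i < d)%N /\ ~~ (L%:Z %| t (n + i)%N)%Z.
  apply: (linear_recurrence_window t_rec a0).
  have [n hn] := tr; exists n => //; apply/negP => /dvdzP[k tk]; apply: hn.
  exists k; rewrite -tk.
  pose q : {poly rat} := (\sum_(i < d) (l i)%:~R *: 'X^i) * 'X^n.
  have evq (F : numFieldType) (x : F) :
      (map_poly ratr q).[x] = (\sum_(i < d) (l i)%:~R * x ^+ i) * x ^+ n.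
    rewrite rmorphM/= map_polyXn hornerM hornerXn rmorph_sum/= horner_sum.
    congr (_ * _); apply: eq_bigr => i _.
    by rewrite map_polyZ/= map_polyXn hornerZ hornerXn ratr_int.
  have -> : L%:R * eta * alpha ^+ n = (map_poly ratr q).[alpha].
    by rewrite evq etaE mulVKf.
  by rewrite (trace_ev minP q urs rsE) tE; apply: eq_bigr => z _; rewrite evq.
apply: (H (fun z => (L%:R)^-1 * lz z) (fun n => eta * alpha ^+ n) t L L0 LA); last 1 first.
- exact: win.
(* The term of alpha in t_n / L is exactly x_n, so only the other conjugates remain. *)
- move=> n; rewrite rmorphB/= fmorph_div/= rmorph_int rmorph_nat tE.
  rewrite (big_rem _ a_rs)/= mulrDl.
  have -> : (eta * alpha ^+ n)%:C%C = lz aC * aC ^+ n / L%:R.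
    have lzE : (\sum_(i < d) (l i)%:~R * alpha ^+ i)%:C%C = lz aC.
      rewrite rmorph_sum/=; apply: eq_bigr => i _.
      by rewrite rmorphM/= rmorphXn/= rmorph_int.
    rewrite etaE !rmorphM/= lzE rmorphXn/= fmorphV rmorph_nat.
    by rewrite -mulrA mulrC.
  rewrite addrC addKr mulr_suml; apply: eq_bigr => z _.
  by rewrite mulrC mulrA.
- exact: (@linear_recurrence_periodic d t a t_rec L L0).
Qed.

End Salem.

(** * Sampling along the flow *)

Section Sampling.
Context {R : realType} {d : nat} (zeta : pa_substitution d) (p : 'rV[R]_d).
Hypothesis p_gt0 : forall a, 0 < p 0 a.
Variables (m M : R).
Hypothesis m_gt0 : 0 < m.
Hypothesis m_le : forall b, m <= p 0 b.
Hypothesis M_ge : forall b, p 0 b <= M.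
Variables (omega : R) (a : 'I_d).
Variables (K : nat) (tau : R).
Hypothesis tau_gt0 : 0 < tau.
Hypothesis K_tau : K%:R * tau = p 0 a.
Variables (x : subshift_type zeta) (s0 : R).
Hypothesis s0_ge0 : 0 <= s0.
Hypothesis s0_lt : s0 < p 0 (val x 0).

Local Notation T := (tile_start p x).

(** The letter x_0 is left out, since the orbit starts inside its tile. *)
Definition tail_word (i : nat) : seq 'I_d :=
  [seq (val x (1 + j%:Z) : 'I_d) | j <- iota 0 i].

Let first_index_ex (y : R) : exists k, y <= k%:R * tau.
Proof.
exists (Num.trunc (y / tau)).+1.
by rewrite -ler_pdivrMr// ltW// truncnS_gt.
Qed.

Let first_index (y : R) : nat := ex_minn (first_index_ex y).

Let first_indexP y k : (k < first_index y)%N = (k%:R * tau < y).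
Proof.
rewrite /first_index; case: ex_minnP => j yj jmin.
have [h|h] := leP y (k%:R * tau); first by rewrite ltnNge jmin.
rewrite -(@ltr_nat R) -(ltr_pM2r tau_gt0).
exact: lt_le_trans h yj.
Qed.

(** Index of the first sampling time at or after the beginning of tile i. *)
Let kap i := first_index (T i - s0).

Let T0 : T 0 = 0. Proof. by rewrite /tile_start big_ord0. Qed.

Let T1 : T 1 = p 0 (val x 0).
Proof. by rewrite tile_startS T0 add0r. Qed.

Let T_mono i j : (i <= j)%N -> T i <= T j.
Proof.
move=> /subnKC <-; elim: (j - i)%N => [|n IH]; first by rewrite addn0.
by rewrite addnS tile_startS (le_trans IH)// lerDl ltW.
Qed.

Let T_ge i : i%:R * m <= T i.
Proof.
elim: i => [|i IH]; first by rewrite mul0r T0.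
by rewrite tile_startS -natr1 mulrDl mul1r lerD.
Qed.

Let kap_le i : T i - s0 <= (kap i)%:R * tau.
Proof. by rewrite leNgt -first_indexP ltnn. Qed.

Let kap_lt i : (0 < i)%N -> (kap i)%:R * tau < T i - s0 + tau.
Proof.
move=> i0; have Ti : 0 < T i - s0 by rewrite subr_gt0 (lt_le_trans s0_lt)// -T1 T_mono.
have k0 : (0 < kap i)%N by rewrite first_indexP mul0r.
have : ((kap i).-1 < kap i)%N by rewrite ltn_predL.
rewrite {2}/kap first_indexP -{2}(prednK k0) -[_.-1.+1%:R]natr1 mulrDl mul1r.
by rewrite ltrD2r.
Qed.

(** The length K tau of the tile is a multiple of the sampling step, so both its ends sit alike in
    the sampling grid. *)
Let kapS i : (0 < i)%N -> val x i%:Z = a -> kap i.+1 = (kap i + K)%N.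
Proof.
move=> i0 xa.
have Ti : 0 < T i - s0 by rewrite subr_gt0 (lt_le_trans s0_lt)// -T1 T_mono.
have E : T i.+1 - s0 = T i - s0 + K%:R * tau.
  by rewrite tile_startS (_ : p 0 _ = p 0 a) ?K_tau; [ring|congr (p 0 _)].
apply/eqP; rewrite eqn_leq; apply/andP; split; rewrite leqNgt; apply/negP.
  rewrite first_indexP E natrD mulrDl ltrD2r -first_indexP.
  by rewrite ltnn.
move: (kap_le i.+1); rewrite leNgt => /negP nlt lt; apply: nlt; rewrite E.
have [nK|Kn] := ltnP (kap i.+1) K.
  have : (kap i.+1)%:R * tau < K%:R * tau by rewrite ltr_pM2r// ltr_nat.
  by move: Ti; lra.
rewrite -(subnK Kn) natrD mulrDl ltrD2r -first_indexP.
by rewrite ltn_subLR// addnC.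
Qed.

Lemma tail_wordS i : tail_word i.+1 = rcons (tail_word i) (val x i.+1%:Z).
Proof.
by rewrite /tail_word -[in LHS]addn1 iotaD map_cat cats1 add0n /= intS.
Qed.

Lemma wlen_tail_word i : wlen p (tail_word i) = T i.+1 - T 1.
Proof.
elim: i => [|i IH]; first by rewrite /wlen big_nil subrr.
rewrite tail_wordS -cats1 wlen_cat wlen1 IH (tile_startS _ _ i.+1); ring.
Qed.

Let sample (phi : R) (k : nat) : R :=
  \1_(@letter_set d zeta R p a) (suspension_pi p (x, s0 + k%:R * tau)) *
  cos (2 * pi * omega * (k%:R * tau) + phi).

Let sample_le1 phi k : sample phi k <= 1.
Proof.
have c1 : cos (2 * pi * omega * (k%:R * tau) + phi) <= 1.
  by rewrite (le_trans (ler_norm _))// cos_max.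
by rewrite /sample indicE; case: (_ \in _); rewrite ?mul1r// mul0r.
Qed.

Let sum_sample_le phi i j : (i <= j)%N ->
  \sum_(i <= k < j) sample phi k <= (j - i)%:R.
Proof.
move=> ij; apply: (@le_trans _ _ (\sum_(i <= k < j) 1)).
  by apply: ler_sum => k _; exact: sample_le1.
by rewrite sumr_const_nat.
Qed.

Let sample_tile phi i k : (kap i <= k)%N -> (k < kap i.+1)%N ->
  sample phi k = (val x i%:Z == a)%:R * cos (2 * pi * omega * (k%:R * tau) + phi).
Proof.
move=> ik ki; rewrite /sample (indic_letter_set_tile p_gt0 a (i := i))//.
apply/andP; split; last by rewrite addrC -ltrBrDr -first_indexP.
by rewrite addrC -lerBlDr leNgt -first_indexP -leqNgt.
Qed.

Let kap_mono i : (kap i <= kap i.+1)%N.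
Proof.
rewrite leqNgt first_indexP -leNgt (le_trans _ (kap_le i.+1))//.
by rewrite lerD2r T_mono.
Qed.

(** [tail_word] starts at time T_1 - s_0, and the sample of rank j in a tile is taken about j tau
    after its beginning. *)
Let phase (phi : R) (j : nat) : R := 2 * pi * omega * (j%:R * tau + T 1 - s0) + phi.

(* A complete tile of letter a contains exactly K sampling times, and they are
   delayed by less than tau with respect to the beginning of the tile. *)
Let sum_full_tiles phi i :
  \sum_(kap 1 <= k < kap i.+1) sample phi k <=
  \sum_(j < K) twisted p omega a (tail_word i) (phase phi j) +
  K%:R * i%:R * (2 * pi * `|omega| * tau).
Proof.
elim: i => [|i IH].
  by rewrite big_geq// mulr0 mul0r addr0 big1.
have k1i : (kap 1 <= kap i.+1)%N.
  by elim: (i) => // n IHn; rewrite (leq_trans IHn).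
rewrite (big_cat_nat k1i (kap_mono _)).
have e0 : 0 <= 2 * pi * `|omega| * tau by rewrite !mulr_ge0 ?pi_ge0 ?(ltW tau_gt0).
under [X in _ <= X + _]eq_bigr do rewrite tail_wordS -cats1 twisted_cat.
have -> : K%:R * i.+1%:R * (2 * pi * `|omega| * tau) =
    K%:R * i%:R * (2 * pi * `|omega| * tau) + K%:R * (2 * pi * `|omega| * tau).
  by rewrite -[i.+1%:R]natr1; ring.
rewrite big_split addrACA; apply: lerD => //.
rewrite (eq_big_nat _ _ (F2 := fun k => (val x i.+1%:Z == a)%:R *
  cos (2 * pi * omega * (k%:R * tau) + phi))); last first.
  by move=> k /andP[? ?]; exact: sample_tile.
case: eqP => [xa|xa]; last first.
  rewrite big1 => [|k _]; last by rewrite mul0r.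
  rewrite big1 => [|j _]; last by rewrite /= (introF eqP xa) mul0r addr0.
  by rewrite add0r mulr_ge0.
have -> : \sum_(kap i.+1 <= k < kap i.+2)
      true%:R * cos (2 * pi * omega * (k%:R * tau) + phi) =
    \sum_(j < K) cos (2 * pi * omega * ((j + kap i.+1)%:R * tau) + phi).
  rewrite (kapS _ xa)// -{1}[kap i.+1]add0n big_addn addKn big_mkord.
  by apply: eq_bigr => j _; rewrite mul1r.
have -> : K%:R * (2 * pi * `|omega| * tau) =
    \sum_(j < K) (2 * pi * `|omega| * tau).
  by rewrite sumr_const card_ord mulr_natl.
rewrite -big_split/=; apply: ler_sum => j _.
rewrite xa eqxx mul1r addr0 wlen_tail_word addrC -lerBlDr.
rewrite (le_trans (ler_norm _))// (le_trans (cos_lipschitz _ _))//.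
rewrite (_ : _ - _ = 2 * pi * omega * ((kap i.+1)%:R * tau - (T i.+1 - s0))); last first.
  by rewrite /phase natrD; ring.
rewrite !normrM normr_nat (ger0_norm (pi_ge0 R)).
apply: ler_wpM2l; first by rewrite !mulr_ge0 ?pi_ge0.
rewrite ger0_norm ?subr_ge0 ?kap_le//.
by have := kap_lt (ltn0Sn i); lra.
Qed.

(** Samples in complete tiles are grouped by rank j < K, each rank giving one twisted sum, with K
    tau = p_a <= M. The first and last tiles cost 2 M + tau. *)
Lemma sampled_sum_le (n : nat) (Q : R) : 0 <= Q -> M <= n%:R * tau ->
  (forall i phi, T i.+1 - s0 <= n%:R * tau ->
     twisted p omega a (tail_word i) phi <= Q) ->
  forall phi,
    tau * \sum_(k < n)
      \1_(@letter_set d zeta R p a) (suspension_pi p (x, s0 + k%:R * tau)) *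
      cos (2 * pi * omega * (k%:R * tau) + phi) <=
    2 * M + tau + M * (Q + 2 * pi * `|omega| * tau * ((M + n%:R * tau) / m)).
Proof.
move=> Q0 Mn HQ phi.
have M0 : 0 < M by exact: lt_le_trans (M_ge a).
have nt0 : 0 <= n%:R * tau by rewrite mulr_ge0// ltW.
have s0M : s0 <= M by rewrite (le_trans (ltW s0_lt)).
have i_bound i : T i - s0 <= n%:R * tau -> i%:R <= (M + n%:R * tau) / m.
  by move=> h; rewrite ler_pdivlMr// (le_trans (T_ge i))//; lra.
have ex1 : exists i, T i.+1 - s0 <= n%:R * tau.
  by exists 0%N; rewrite T1 (le_trans _ Mn)// lerBlDr (le_trans (M_ge _))// lerDl.
have bnd i : T i.+1 - s0 <= n%:R * tau -> (i <= Num.trunc ((M + n%:R * tau) / m))%N.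
  move=> h; have q0 : 0 <= (M + n%:R * tau) / m.
    by rewrite divr_ge0 ?addr_ge0 ?(ltW M0) ?(ltW m_gt0).
  rewrite (truncn_ge_nat _ q0).
  by rewrite (le_trans _ (i_bound _ h))// ler_nat.
(* Tile i is the last one completed by time n tau. *)
case: (ex_maxnP ex1 bnd) => i hi imax {ex1 bnd}.
have kin : (kap i.+1 <= n)%N by rewrite leqNgt first_indexP -leNgt.
have nki : (n < kap i.+2)%N.
  rewrite first_indexP ltNge; apply/negP => /imax; by rewrite ltnn.
have k1i : (kap 1 <= kap i.+1)%N.
  by elim: (i) => // j IHj; rewrite (leq_trans IHj).
have -> : \sum_(k < n) \1_(@letter_set d zeta R p a) (suspension_pi p (x, s0 + k%:R * tau)) *
      cos (2 * pi * omega * (k%:R * tau) + phi) = \sum_(0 <= k < n) sample phi k.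
  by rewrite big_mkord.
rewrite (big_cat_nat (leq0n (kap 1)) (leq_trans k1i kin))/=.
rewrite (big_cat_nat k1i kin)/=.
have h1 := sum_sample_le phi (leq0n (kap 1)).
have h2 := sum_full_tiles phi i.
have h3 := sum_sample_le phi kin.
have h2' : \sum_(j < K) twisted p omega a (tail_word i) (phase phi j) <= K%:R * Q.
  rewrite mulr_natl -[K in leRHS]card_ord -sumr_const.
  by apply: ler_sum => j _; exact: HQ.
have kt1 : (kap 1)%:R * tau <= M + tau.
  have := kap_lt (ltn0Sn 0); rewrite T1 => /ltW/le_trans; apply.
  by rewrite lerD2r (le_trans _ (M_ge (val x 0)))// gerBl.
have kt2 : (n - kap i.+1)%:R * tau <= M.
  rewrite natrB// mulrBl.
  have := nki; rewrite first_indexP tile_startS.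
  have : p 0 (val x i.+1%:Z) <= M by exact: M_ge.
  move: (p 0 _) => q qM; have := kap_le i.+1; lra.
rewrite subn0 in h1.
have Kt : K%:R * tau <= M by rewrite K_tau.
have ib : i%:R <= (M + n%:R * tau) / m.
  by rewrite (le_trans _ (i_bound _ hi))// ler_nat.
set e := 2 * pi * `|omega| * tau in h2 *.
have e0 : 0 <= e by rewrite !mulr_ge0 ?pi_ge0 ?(ltW tau_gt0).
have ie : i%:R * e <= e * ((M + n%:R * tau) / m) by rewrite mulrC ler_wpM2l.
have main : K%:R * tau * (Q + i%:R * e) <= M * (Q + e * ((M + n%:R * tau) / m)).
  apply: ler_pM => //; first by rewrite mulr_ge0 ?(ltW tau_gt0).
    by rewrite addr_ge0// mulr_ge0.
  by rewrite lerD2l.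
set S1 := \sum_(0 <= k < kap 1) _ in h1 *.
set S2 := \sum_(kap 1 <= k < kap i.+1) _ in h2 *.
set S3 := \sum_(kap i.+1 <= k < n) _ in h3 *.
have {}h1 : tau * S1 <= M + tau.
  by rewrite (le_trans _ kt1)// mulrC ler_pM2r.
have {}h3 : tau * S3 <= M.
  by rewrite (le_trans _ kt2)// mulrC ler_pM2r.
have {}h2 : tau * S2 <= K%:R * tau * (Q + i%:R * e).
  rewrite (_ : K%:R * tau * (Q + i%:R * e) = tau * (K%:R * Q + K%:R * i%:R * e)); last by ring.
  by rewrite ler_pM2l// (le_trans h2)// lerD2r.
by rewrite !mulrDr; move: h1 h2 h3 main; rewrite !mulrDr; lra.
Qed.

End Sampling.

(** * From twisted sums to correlation measures *)

Section CorrelationMeasure.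
Context {R : realType} {d : nat} (zeta : pa_substitution d) (p : 'rV[R]_d).
Variable alpha : R.
Hypothesis p_gt0 : forall a, 0 < p 0 a.
Hypothesis alpha_gt1 : 1 < alpha.
Hypothesis p_eigen : p *m map_mx (fun n => n%:R : R) (subst_mx zeta) = alpha *: p.
Variables (m M : R).
Hypothesis m_gt0 : 0 < m.
Hypothesis m_le : forall b, m <= p 0 b.
Hypothesis M_ge : forall b, p 0 b <= M.
Local Notation subst n := (iter n (subst_word zeta)).

Lemma tail_word_infix (x : subshift_type zeta) (i : nat) :
  exists b K, infix (tail_word x i) (subst K [:: b]).
Proof.
case: i => [|i]; first by exists (val x 0), 0%N; rewrite infix0s.
exact: (set_mem (valP x) 1 i).
Qed.

(** N samples of step tau, with N tau between 1 / (16 r) and 1 / (8 r), feed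
    [spectral_interval_bound]. The words read meanwhile obey [twisted_language_le], and tau is so
    small that the sampling error is at most 1. *)
Lemma correlation_interval_bound (mu : probability (suspension zeta p) R)
    (nu : {finite_measure set (measurableTypeR R) -> \bar R}) (a : 'I_d)
    (omega V r : R) (n : nat) :
  flow_invariant mu -> is_correlation_measure mu a nu -> 0 <= V ->
  (forall b phi, twisted p omega a (subst n [:: b]) phi <=
                 V * wlen p (subst n [:: b])) ->
  0 < r -> 16 * M * r <= 1 ->
  (nu `[(omega - r)%R, (omega + r)%R]%classic <=
     (4 * (16 * r * (3 * M + 1 + M * (V / (8 * r) + 2 * (alpha ^+ n * M / m))))
       ^+ 2)%:E)%E.
Proof.
move=> mu_inv nu_corr V0 HV r0 rM.
have M0 : 0 < M by exact: lt_le_trans (M_ge a).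
have a0 : 0 < alpha by exact: lt_trans alpha_gt1.
have r8 : 0 < 8 * r by rewrite mulr_gt0.
set Q := V / (8 * r) + 2 * (alpha ^+ n * M / m).
have Q0 : 0 <= Q.
  by rewrite addr_ge0 ?divr_ge0 ?mulr_ge0 ?exprn_ge0 ?invr_ge0// ltW.
pose e := 8 * `|omega| * ((M + (8 * r)^-1) / m).
have e0 : 0 <= e.
  by rewrite /e mulr_ge0 ?divr_ge0 ?addr_ge0 ?invr_ge0 ?mulr_ge0// ltW.
(* The inequality tau D <= 1 yields at once tau <= 1, 16 r tau <= 1 and e tau <= 1. *)
pose D := 1 + 16 * r + e.
have D1 : 1 <= D by rewrite /D; lra.
pose K := (Num.trunc (p 0 a * D)).+1.
have K0 : 0 < K%:R :> R by rewrite ltr0n.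
pose tau := p 0 a / K%:R.
have tau0 : 0 < tau by rewrite divr_gt0.
have Ktau : K%:R * tau = p 0 a by rewrite mulrC divfK// gt_eqF.
have tauD : tau * D <= 1.
  by rewrite /tau mulrAC ler_pdivrMr// mul1r ltW// truncnS_gt.
clearbody tau.
have tau1 : tau <= 1 by rewrite (le_trans _ tauD)// ler_peMr// ltW.
have tau16 : tau * (16 * r) <= 1.
  by rewrite (le_trans _ tauD)// ler_pM2l// /D; lra.
have taue : tau * e <= 1.
  by rewrite (le_trans _ tauD)// ler_pM2l// /D; move: r0; lra.
(* The 8 stems from 2 pi <= 8, as 2 pi N tau r <= 1 is required. *)
pose N := Num.trunc (8 * r * tau)^-1.
have rt0 : 0 < 8 * r * tau by rewrite mulr_gt0.
have Nle : N%:R * tau <= (8 * r)^-1.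
  have : N%:R <= (8 * r * tau)^-1 by rewrite truncn_le invr_ge0 ltW.
  move=> /(ler_wpM2r (ltW tau0)); rewrite invfM -mulrA mulVf ?mulr1// gt_eqF//.
have Nge : (16 * r)^-1 <= N%:R * tau.
  have : (8 * r * tau)^-1 < N%:R + 1 by rewrite natr1 truncnS_gt.
  rewrite -(ltr_pM2r tau0) invfM -mulrA mulVf ?mulr1 ?gt_eqF// => h.
  have : tau <= (16 * r)^-1 by rewrite -[leRHS]mul1r ler_pdivlMr// mulr_gt0.
  have : (8 * r)^-1 = 2 * (16 * r)^-1 by field; rewrite gt_eqF.
  by move: h; rewrite mulrDl; lra.
have r16 : 0 < (16 * r)^-1 by rewrite invr_gt0 mulr_gt0.
have Nt0 : 0 < N%:R * tau by exact: lt_le_trans Nge.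
have N0 : (0 < N)%N by rewrite lt0n; apply/eqP => N0; rewrite N0 mul0r ltxx in Nt0.
have MN : M <= N%:R * tau.
  apply: le_trans Nge; rewrite -[leRHS]mul1r ler_pdivlMr ?mulr_gt0//.
  by move: rM; lra.
pose X := 3 * M + 1 + M * Q.
have X0 : 0 <= X by rewrite /X addr_ge0 ?mulr_ge0// ?addr_ge0 ?mulr_ge0// ltW.
have key y phi : \sum_(k < N) \1_(@letter_set d zeta R p a) (flow (k%:R * tau) y) *
    cos (2 * pi * omega * (k%:R * tau) + phi) <= X / tau.
  have [[x s0] [-> /= /andP[s00 s0p]]] := fundamental_domain_surj p_gt0 y.
  under eq_bigr do rewrite flow_pi.
  rewrite ler_pdivlMr// mulrC.
  have HQ i psi : tile_start p x i.+1 - s0 <= N%:R * tau ->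
      twisted p omega a (tail_word x i) psi <= Q.
    move=> Ti; have [b [K' Kb]] := tail_word_infix x i.
    rewrite (le_trans (twisted_language_le p_gt0 alpha_gt1 p_eigen m_gt0 m_le M_ge V0 HV psi Kb))//.
    rewrite /Q lerD2r ler_wpM2l// (le_trans _ Nle)// (le_trans _ Ti)//.
    rewrite wlen_tail_word.
    rewrite lerD2l lerN2 ltW//.
    by rewrite tile_startS /tile_start big_ord0 add0r.
  have := sampled_sum_le p_gt0 m_gt0 m_le M_ge tau0 Ktau s00 s0p Q0 MN HQ phi.
  move=> /le_trans; apply.
  have : 2 * pi * `|omega| * tau * ((M + N%:R * tau) / m) <= 1.
    apply: le_trans taue; rewrite /e.
    rewrite (_ : tau * _ = 2 * 4 * `|omega| * tau * ((M + (8 * r)^-1) / m)); last by ring.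
    apply: ler_pM.
    - by rewrite !mulr_ge0 ?pi_ge0 ?(ltW tau0).
    - by rewrite divr_ge0 ?addr_ge0 ?(ltW M0) ?(ltW m_gt0) ?(ltW Nt0).
    - apply: ler_wpM2r; first exact: ltW.
      apply: ler_wpM2r => //; apply: ler_wpM2l => //; exact: pi_le4.
    - by rewrite ler_wpM2r ?invr_ge0 ?(ltW m_gt0)// lerD2l.
  set E := 2 * pi * _ * _ * _ => E1.
  have : M * (Q + E) <= M * (Q + 1) by rewrite ler_pM2l// lerD2l.
  by rewrite /X !(mulrDr M) mulr1; move: tau1; lra.
have hN : 2 * pi * (N%:R * tau) * r <= 1.
  have h1 : 2 * pi * (N%:R * tau) <= 8 * (8 * r)^-1.
    apply: ler_pM; rewrite ?mulr_ge0 ?pi_ge0 ?(ltW Nt0) ?(ltW tau0)//.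
    by have := @pi_le4 R; lra.
  apply: (@le_trans _ _ (8 * (8 * r)^-1 * r)); first by rewrite ler_wpM2r ?(ltW r0).
  have -> : 8 * (8 * r)^-1 * r = 1 by field; rewrite gt_eqF.
  exact: lexx.
have := spectral_interval_bound (measurable_letter_set p_gt0 a)
  (@measurable_flow d zeta R p) (@flowD d zeta R p) mu_inv nu_corr N0 (ltW tau0)
  (ltW r0) hN key.
move=> /le_trans; apply; rewrite lee_fin.
rewrite (_ : 4 * (X / tau) ^+ 2 / N%:R ^+ 2 = 4 * (X / (N%:R * tau)) ^+ 2); last first.
  by field; rewrite !gt_eqF ?ltr0n.
have XN : X / (N%:R * tau) <= 16 * r * X.
  rewrite ler_pdivrMr// mulrAC -{1}[X]mul1r; apply: ler_wpM2r => //.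
  have := ler_wpM2l (ltW (mulr_gt0 (ltr0Sn R 15) r0)) Nge.
  by rewrite mulfV// gt_eqF// mulr_gt0.
have XN0 : 0 <= X / (N%:R * tau) by rewrite divr_ge0// ltW.
by rewrite ler_pM2l// lerXn2r ?nnegrE// (le_trans XN0).
Qed.

End CorrelationMeasure.

(** * Lengths of words as elements of Z[alpha] *)

Section Ring.
Context {R : realType} (alpha : R).

Lemma Zadjoin_Qadjoin (x : R) : Zadjoin alpha x -> Qadjoin alpha x.
Proof.
move=> [q ->]; exists (map_poly intr q), 1.
rewrite rmorph1 hornerC divr1 -map_poly_comp; congr (_ .[_]).
by apply: eq_map_poly => c /=; rewrite ratr_int.
Qed.

Lemma Zadjoin_wlen d (p : 'rV[R]_d) (w : seq 'I_d) :
  (forall a, Zadjoin alpha (p 0 a)) -> Zadjoin alpha (wlen p w).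
Proof.
move=> pZ; elim: w => [|b w [q qE]].
  by exists 0; rewrite /wlen big_nil rmorph0 horner0.
have [q' q'E] := pZ b; exists (q' + q).
by rewrite wlen_cons qE q'E rmorphD hornerD.
Qed.

End Ring.

(** * Choice of the scale n for a given radius *)

Section Decay.
Context {R : realType}.

(* n is chosen with alpha^(2n) <= 1/r < alpha^(2n+2): both error terms, of
   relative size exp(- g n) and alpha^(- n), are then powers of r. *)
Lemma scale_choice (alpha r g W M m : R) (N1 : nat) :
  1 < alpha -> 0 < m -> 0 < M -> 0 <= W ->
  0 < g -> g <= ln alpha -> 0 < r -> r < expR (- (2 * N1%:R * ln alpha)) ->
  exists2 n : nat, (N1 <= n)%N &
    4 * (16 * r * (3 * M + 1 + M * (W * expR (- (g * n%:R)) / (8 * r) +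
        2 * (alpha ^+ n * M / m)))) ^+ 2 <=
    4 * (16 * (3 * M + 1) + 2 * M * W + 32 * M ^+ 2 / m) ^+ 2 * alpha ^+ 2 *
      r `^ (g / ln alpha).
Proof.
move=> al m0 M0 W0 g0 gl r0 rN1.
have a0 : 0 < alpha by exact: lt_trans al.
have l0 : 0 < ln alpha by rewrite ln_gt0.
have lr : 2 * N1%:R * ln alpha < - ln r.
  rewrite ltrNr -[X in _ < X]expRK ltr_ln ?posrE ?expR_gt0//.
pose y := - ln r / (2 * ln alpha).
have y0 : N1%:R <= y.
  by rewrite /y ler_pdivlMr ?mulr_gt0// mulrA (mulrC _ 2) ltW.
pose n := Num.trunc y; exists n.
  by rewrite truncn_ge_nat// (le_trans _ y0).
have ny : n%:R <= y by rewrite truncn_le (le_trans _ y0).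
have yn : y < n%:R + 1 by rewrite natr1 truncnS_gt.
have {}ny : ln r <= - (2 * n%:R * ln alpha).
  by move: ny; rewrite /y ler_pdivlMr ?mulr_gt0// => ny; lra.
have {}yn : - (2 * (n%:R + 1) * ln alpha) <= ln r.
  by move: yn; rewrite /y ltr_pdivrMr ?mulr_gt0// => yn; lra.
clearbody n.
set e := expR (- (g * n%:R)).
have e0 : 0 < e by exact: expR_gt0.
have anE k : alpha ^+ k = expR (k%:R * ln alpha).
  by rewrite mulrC expRM_natr lnK// posrE.
have rE : r = expR (ln r) by rewrite lnK// posrE.
have re : r <= e.
  rewrite rE ler_expR (le_trans ny)// lerN2.
  have : g * n%:R <= ln alpha * n%:R by rewrite ler_wpM2r.
  have : 0 <= ln alpha * n%:R by rewrite mulr_ge0// ltW.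
  by lra.
have rae : r * alpha ^+ n <= e.
  rewrite anE rE -expRD ler_expR.
  have : g * n%:R <= ln alpha * n%:R by rewrite ler_wpM2r.
  by lra.
set C := 16 * (3 * M + 1) + 2 * M * W + 32 * M ^+ 2 / m.
have h : 16 * r * (3 * M + 1 + M * (W * e / (8 * r) + 2 * (alpha ^+ n * M / m))) <= C * e.
  have -> : 16 * r * (3 * M + 1 + M * (W * e / (8 * r) + 2 * (alpha ^+ n * M / m))) =
    16 * (3 * M + 1) * r + 2 * M * W * e + 32 * M ^+ 2 / m * (r * alpha ^+ n).
    by field; rewrite !gt_eqF.
  have -> : C * e = 16 * (3 * M + 1) * e + 2 * M * W * e + 32 * M ^+ 2 / m * e.
    by rewrite /C; ring.
  apply: lerD; last first.
    by apply: ler_wpM2l => //; rewrite divr_ge0 ?(ltW m0)// mulr_ge0// sqr_ge0.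
  rewrite lerD2r; apply: ler_wpM2l => //.
  by move: M0; lra.
have h0 : 0 <= 16 * r * (3 * M + 1 + M * (W * e / (8 * r) + 2 * (alpha ^+ n * M / m))).
  rewrite mulr_ge0 ?mulr_ge0 ?(ltW r0)// addr_ge0//; first by move: M0; lra.
  rewrite mulr_ge0 ?(ltW M0)// addr_ge0//.
    by rewrite divr_ge0 ?mulr_ge0 ?(ltW e0) ?(ltW r0).
  by rewrite mulr_ge0// divr_ge0 ?mulr_ge0 ?exprn_ge0 ?(ltW a0) ?(ltW M0) ?(ltW m0).
apply: (@le_trans _ _ (4 * (C * e) ^+ 2)).
  by rewrite ler_pM2l// lerXn2r ?nnegrE// (le_trans h0).
rewrite exprMn mulrA -[leRHS]mulrA; apply: ler_wpM2l.
  by rewrite mulr_ge0// sqr_ge0.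
rewrite /e -expRM_natr anE /powR gt_eqF// -expRD ler_expR.
(* The lower bound on r involves n + 1 instead of n; the factor alpha^2 absorbs the difference. *)
have := ler_wpM2l (ltW (divr_gt0 g0 l0)) yn.
rewrite (_ : g / ln alpha * - _ = - (2 * (n%:R + 1) * g)); last by field; rewrite gt_eqF.
by move: gl; lra.
Qed.

End Decay.

Theorem theorem1p2 (R : realType) (d : nat) (d_ge4 : (4 <= d)%N)
    (d_even : ~~ odd d) (zeta : pa_substitution d)
    (alpha : R) (alpha_dom : is_dominant_eigenvalue (subst_mx zeta) alpha)
    (alpha_salem : is_salem alpha) (alpha_deg : has_degree alpha d)
    (p : 'rV[R]_d) (p_gt0 : forall a, 0 < p 0 a)
    (p_eigen : p *m map_mx (fun n => n%:R : R) (subst_mx zeta) = alpha *: p)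
    (p_int : forall a, Zadjoin alpha (p 0 a)) :
  exists kappa c : R,
    [/\ Qadjoin alpha kappa, 0 < kappa, 0 < c &
    forall A : R, 1 < A -> exists2 gamma : R, 0 < gamma &
    forall (omega : R) (L : nat) (l : 'I_d -> int),
      Qadjoin alpha omega -> omega != 0 ->
      reduced_form alpha (omega * kappa) L l ->
      (exists n : 'I_d, ~ exists k : int,
         trace alpha (L%:R * kappa * omega * alpha ^+ n) = (k * L%:Z)%:~R) ->
      L%:R <= A ->
      exists2 r0 : R, 0 < r0 &
      forall (mu : probability (suspension zeta p) R)
             (nu : 'I_d -> {finite_measure set (measurableTypeR R) -> \bar R}),
        flow_invariant mu ->
        (forall a, is_correlation_measure mu a (nu a)) ->
        forall (r : R) (a : 'I_d), 0 < r < r0 ->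
          (nu a `[(omega - r)%R, (omega + r)%R]%classic <= (c * r `^ gamma)%:E)%E].
Proof.
have d0 : (0 < d)%N by exact: leq_trans d_ge4.
have [_ alpha1 _ _] := alpha_salem.
have a0 : 0 < alpha by exact: lt_trans alpha1.
have l0 : 0 < ln alpha by rewrite ln_gt0.
have [m m0 m_le] := min_entry p_gt0.
pose M := \sum_b p 0 b.
have M_ge b : p 0 b <= M.
  by rewrite /M (bigD1 b)//= lerDl; apply: sumr_ge0 => j _; exact: ltW.
have M0 : 0 < M by exact: lt_le_trans (M_ge (Ordinal d0)).
have [c [v [k [k0 cvc]]]] :=
  common_return_word (leq_trans (isT : 2 <= 4)%N d_ge4) (pa_primitive zeta).
have k0' : 0 < k%:R :> R by rewrite ltr0n.
(* A sum of entries of p, hence positive and in Z[alpha]. *)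
pose kappa := wlen p (c :: v).
(* The constant of [scale_choice] for W = 1 / m, free of A and omega. *)
pose C := 16 * (3 * M + 1) + 2 * M * m^-1 + 32 * M ^+ 2 / m.
have C0 : 0 < C.
  rewrite /C addr_gt0// ?divr_gt0 ?mulr_gt0 ?exprn_gt0// addr_gt0 ?mulr_gt0 ?invr_gt0//.
  by move: M0; lra.
exists kappa, (4 * C ^+ 2 * alpha ^+ 2); split.
- exact/Zadjoin_Qadjoin/Zadjoin_wlen.
- by rewrite /kappa wlen_cons ltr_pwDl// wlen_ge0.
- by rewrite !mulr_gt0 ?exprn_gt0.
move=> A A1.
have [rho rho0 Hrho] := salem_density d0 alpha_dom.1 alpha_salem alpha_deg A.
pose c0 := p 0 c / (alpha ^+ k * M).
have c00 : 0 < c0 by rewrite divr_gt0 ?mulr_gt0 ?exprn_gt0.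
have ck0 : 0 < c0 / k%:R by exact: divr_gt0.
(* The rate rho / 2 comes from n - k >= n / 2, and the minimum from the hypothesis g <= ln alpha of
   [scale_choice]. A enters only through rho. *)
pose g := Num.min (ln alpha) (c0 / k%:R * (rho / 2)).
have g0 : 0 < g.
  by rewrite lt_min l0/=; apply: mulr_gt0 => //; apply: divr_gt0.
have gl : g <= ln alpha by rewrite ge_min lexx.
have gr : g <= c0 / k%:R * (rho / 2) by rewrite ge_min lexx orbT.
(* Since alpha^(2 n) is of order 1 / r, the square exp(- 2 g n) is of order r^(g / ln alpha). *)
exists (g / ln alpha); first by rewrite divr_gt0.
move=> omega L l _ _ red tr LA.
have [N0 HN0] : exists N0, forall N, (N0 <= N)%N ->
    rho * N%:R <= \sum_(n < N) sin (pi * (omega * kappa * alpha ^+ n)) ^+ 2.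
  apply: (Hrho _ L l) => //.
  by have [n hn] := tr; exists n; rewrite (mulrC omega) mulrA.
have decay n a b phi : (N0 + 2 * k <= n)%N ->
    twisted p omega a (iter n (subst_word zeta) [:: b]) phi <=
    m^-1 * expR (- (g * n%:R)) * wlen p (iter n (subst_word zeta) [:: b]).
  move=> nN; have kn : (k <= n)%N by clear -nN; lia.
  have := twisted_iter_bound p_gt0 alpha1 p_eigen m0 m_le M_ge omega a k0 cvc (n - k) b phi.
  rewrite subnK// -/c0 -/kappa => /le_trans; apply.
  rewrite (wlen_iter_subst p_eigen) wlen1.
  set E := expR (- (c0 / k%:R * _)).
  rewrite (_ : m^-1 * alpha ^+ n * E * p 0 b = m^-1 * E * (alpha ^+ n * p 0 b));
    last by ring.
  apply: ler_wpM2r; first by rewrite mulr_ge0 ?exprn_ge0 ?(ltW a0) ?(ltW (p_gt0 b)).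
  rewrite ler_pM2l ?invr_gt0// ler_expR lerN2.
  have nk : n%:R / 2 <= (n - k)%:R :> R.
    by rewrite ler_pdivrMr// -natrM ler_nat; clear -nN; lia.
  apply: (@le_trans _ _ (c0 / k%:R * (rho * (n - k)%:R))); last first.
    by rewrite (ler_pM2l ck0); apply: HN0; clear -nN; lia.
  apply: (@le_trans _ _ (c0 / k%:R * (rho / 2) * n%:R)).
    by rewrite ler_wpM2r.
  rewrite -[leLHS]mulrA (ler_pM2l ck0) -mulrA (ler_pM2l rho0).
  by rewrite mulrC.
(* The first bound gives 16 M r <= 1; the second makes the scale n at least N0 + 2 k, where [decay]
   applies. *)
pose r0 := Num.min (16 * M)^-1 (expR (- (2 * (N0 + 2 * k)%:R * ln alpha))).
exists r0; first by rewrite lt_min invr_gt0 mulr_gt0//= expR_gt0.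
move=> mu nu mu_inv nu_corr r a /andP[r_gt0]; rewrite lt_min => /andP[rM rN].
have rM1 : 16 * M * r <= 1.
  by rewrite mulrC -ler_pdivlMr ?mulr_gt0// mul1r ltW.
have mV : 0 <= m^-1 by rewrite invr_ge0 ltW.
have [n nN h] := scale_choice alpha1 m0 M0 mV g0 gl r_gt0 rN.
have V0 : 0 <= m^-1 * expR (- (g * n%:R)) by rewrite mulr_ge0// expR_ge0.
have := correlation_interval_bound p_gt0 alpha1 p_eigen m0 m_le M_ge mu_inv
  (nu_corr a) V0 (fun b phi => decay n a b phi nN) r_gt0 rM1.
by move=> /le_trans; apply; rewrite lee_fin.
Qed.
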